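(* Let $T:[0,l]\to[0,l]$ be an infinitely renormalizable interval exchange transformation (of finite or infinite type). Then $T$ is combinatorially minimal if and only if $T$ has no connections and is minimal.
   Context: **IETs.** Let $\mathcal A$ be a countable set. An interval exchange transformation (IET) on $\mathcal A$ is a map $T$ of $[0,l]$ to itself with two families of pairwise disjoint nonempty open subintervals $I^t_\alpha=(l^t_\alpha,r^t_\alpha)$ (top intervals) and $I^b_\alpha=(l^b_\alpha,r^b_\alpha)$ (bottom intervals), $\alpha\in\mathcal A$, each family partitioning $[0,l]$ up to the singular sets $\mathcal S^t=[0,l]\setminus\bigsqcup_\alpha I^t_\alpha$ and $\mathcal S^b=[0,l]\setminus\bigsqcup_\alpha I^b_\alpha$, such that $T|_{I^t_\alpha}$ is a translation with image $I^b_\alpha$. Standing assumption: the sets $Acc(\mathcal S^t)$, $Acc(\mathcal S^b)$ of accumulation points are finite. Values of $T$ on $\mathcal S^t$ (and of $T^{-1}$ on $\mathcal S^b$) play no role. An accumulation point is right-sided (left-sided) if it is accumulated by singularities from the right (left); it may be both. **Orbits.** For $x\notin\mathcal S^t$, $\mathcal O^+(x)$ is the set of $y$ such that for some $N\ge 0$, $T^n(x)\notin\mathcal S^t$ for all $n<N$ and $T^N(x)=y$. For $x\notin\mathcal S^b$, $\mathcal O^-(x)$ is defined in the same way with $T^{-1},\mathcal S^b$. For $x\notin\mathcal S^t\cup\mathcal S^b$, $\mathcal O(x)=\mathcal O^+(x)\cup\mathcal O^-(x)$. A connection is an orbit which is finite both forward and backward; a point of $(0,l)$ lying in $\mathcal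 S^t\cap\mathcal S^b$ is also regarded as a connection. $T$ is minimal if every infinite orbit (including those that are finite in one of the two time directions) is dense in $[0,l]$. **Rauzy–Veech induction.** Let $s^t_{\max}=\max Acc(\mathcal S^t)$, $s^b_{\max}=\max Acc(\mathcal S^b)$, and $s^t_{\min},s^b_{\min}$ the corresponding minima (conditions on them are vacuous when the sets are empty). Assume not $s^t_{\max}=s^b_{\max}=l$. Let $\alpha_t,\alpha_b$ be, when they exist, the labels of the rightmost top and bottom intervals ($r^t_{\alpha_t}=l$, $r^b_{\alpha_b}=l$). Define $l^{(1)}$: (1) (a tail plays, right-sided) if $s^t_{\max},s^b_{\max}\neq l$ and $s^b_{\max}\in I^t_{\alpha_t}$ is right-sided, then $l^{(1)}=s^b_{\max}$; respectively if $s^t_{\max}\in I^b_{\alpha_b}$ is right-sided, then $l^{(1)}=s^t_{\max}$; (2) (a tail plays, left-sided) if $s^b_{\max}=l$ then $l^{(1)}=\min(\mathcal S^b\cap I^t_{\alpha_t})$; respectively if $s^t_{\max}=l$ then $l^{(1)}=\min(\mathcal S^t\cap I^b_{\alpha_b})$; (3) (two intervals play) in the remaining cases $l^{(1)}=\max(l^t_{\alpha_t},l^b_{\alpha_b})$. The step is well defined if $l^{(1)}\notin\mathcal S^t\cap\mathcal S^b$ (otherwise $T$ has a connection). Then exactly one $w\in\{\alpha_t,\alpha_b\}$ satisfies $l^{(1)}\in I^t_w$ with $w=\alpha_t$ (top wins) or $l^{(1)}\in I^b_w$ with $w=\alpha_b$ (bottom wins); $w$ is the winning label. The set $\mathcal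 L$ of losing labels consists of those $\alpha$ whose bottom (if top wins), resp. top (if bottom wins), interval is contained in $[l^{(1)},l]$. $T^{(1)}$ is the first return map of $T$ to $I^{(1)}=[0,l^{(1)}]$, an IET on $\mathcal A$ labelled as follows: if top wins, $I^{t,(1)}_\gamma=I^t_\gamma\cap[0,l^{(1)}]$ for all $\gamma$; if bottom wins, $I^{t,(1)}_\gamma=T^{-1}(I^b_\gamma\cap[0,l^{(1)}])$ for $\gamma\notin\mathcal L$ and $I^{t,(1)}_\gamma=T^{-1}(I^t_\gamma)$ for $\gamma\in\mathcal L$; in both cases $T^{(1)}=T$ on $I^{t,(1)}_\gamma$ for $\gamma\notin\mathcal L$ and $T^{(1)}=T^2$ on $I^{t,(1)}_\gamma$ for $\gamma\in\mathcal L$. **Renormalizability.** $T$ is renormalizable if (i) $s^t_{\max},s^b_{\max}$ are not both equal to $l$; (ii) $s^t_{\min},s^b_{\min}$ are not both equal to $0$; (iii) the left endpoints of the playing intervals are not equal (i.e. the step above is well defined). $T$ is infinitely renormalizable if this can be iterated indefinitely: $T$ and all successive IETs $T^{(n)}:[0,l^{(n)}]\to[0,l^{(n)}]$, $n\ge1$, are renormalizable. **Matrices.** If $w^{(n)}$ and $\mathcal L^{(n)}$ are the winner and losers of the $n$-th induction step ($n\ge1$), put $M^{(n)}=\mathrm{Id}+E_{w^{(n)}\mathcal L^{(n)}}$, an $\mathcal A\times\mathcal A$ matrix, where $E_{w\mathcal L}$ has entry $1$ in row $w$ and columns indexed by $\mathcal L$ and $0$ elsewhere. For $m<n$, $M^{(m,n)}=M^{(m)}M^{(m+1)}\cdots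 M^{(n)}$. $T$ is combinatorially minimal if for all $\alpha,\beta\in\mathcal A$ and all $k\in\mathbb N$ there exists $n\in\mathbb N$ with $M^{(k,k+n)}_{\alpha,\beta}>0$. *)

(* Defs.v *)
From HB Require Import structures.
From mathcomp Require Import all_boot all_order all_algebra.
From mathcomp Require Import all_classical all_reals all_analysis.

Set Implicit Arguments.
Unset Strict Implicit.
Unset Printing Implicit Defensive.

Import Order.TTheory GRing.Theory Num.Theory.
Import numFieldNormedType.Exports.

Local Open Scope classical_set_scope.
Local Open Scope ring_scope.

(* The data of an interval exchange on [0, len]: the endpoints of the top
   intervals ]ltop a, rtop a[ and of the bottom intervals ]lbot a, rbot a[.
   They determine the transformation away from the singularities, where its
   values are irrelevant; see [imap]. *)
Record iet (R : realType) (A : countType) := Iet {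
  len : R;
  ltop : A -> R;
  rtop : A -> R;
  lbot : A -> R;
  rbot : A -> R }.

Section IET.
Variables (R : realType) (A : countType).
Implicit Types (T : iet R A) (a b g w : A) (c s x y : R) (E : set R).

(* Interval exchange for T^-1: exchanges top and bottom. All the notions below
   are written for the top intervals; their bottom counterparts are those of
   [inv_iet T]. *)
Definition inv_iet T : iet R A :=
  Iet (len T) (lbot T) (rbot T) (ltop T) (rtop T).

Definition dom T : set R := `[0, len T].

Definition top T a : set R := `]ltop T a, rtop T a[.
Definition bot T a : set R := top (inv_iet T) a.

Definition stop T : set R := dom T `\` \bigcup_a top T a.
Definition sbot T : set R := stop (inv_iet T).

Definition is_iet_top T : Prop :=
  [/\ forall a, ltop T a < rtop T a,
      forall a, top T a `<=` dom T,
      trivIset setT (top T) &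
      finite_set (limit_point (stop T))].

Definition is_iet T : Prop :=
  [/\ 0 < len T, is_iet_top T, is_iet_top (inv_iet T) &
      forall a, rtop T a - ltop T a = rbot T a - lbot T a].

(* The transformation: the translation of [top T a] onto [bot T a]; the default
   value x is only taken at points outside all the top intervals. *)
Definition imap T x : R :=
  xget x [set y | exists2 a, top T a x & y = x + (lbot T a - ltop T a)].

Definition iinv T : R -> R := imap (inv_iet T).

(* For x in [stop T] this is [set x]. *)
Definition forward_orbit T x : set R :=
  [set y | exists2 N : nat,
     forall n : nat, (n < N)%N -> ~ stop T (iter n (imap T) x)
     & iter N (imap T) x = y].

Definition backward_orbit T x : set R := forward_orbit (inv_iet T) x.

(* For x in [sbot T `\` stop T] this is the forward orbit of x, for x in
   [stop T `\` sbot T] the backward one: half-infinite orbits are included. *)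
Definition orbit T x : set R := forward_orbit T x `|` backward_orbit T x.

(* The point x may be a singularity: a point of ]0, len T[ in
   [stop T `&` sbot T] is a connection (both half-orbits are [set x]), and so
   is a two-point orbit {x, T x} with x in [sbot T] and T x in [stop T]. *)
Definition connection T x : Prop :=
  [/\ 0 < x < len T, finite_set (forward_orbit T x) &
      finite_set (backward_orbit T x)].

Definition no_connection T : Prop := forall x, ~ connection T x.

Definition minimal T : Prop :=
  forall x, dom T x -> infinite_set (orbit T x) ->
    dom T `<=` closure (orbit T x).

Definition is_max E x : Prop := E x /\ ubound E x.
Definition is_min E x : Prop := E x /\ lbound E x.

(* [acc_max T s] says that the largest accumulation point of [stop T] exists
   and is s; it fails for every s when there is no accumulation point. *)
Definition acc_max T s : Prop := is_max (limit_point (stop T)) s.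
Definition acc_min T s : Prop := is_min (limit_point (stop T)) s.

Definition right_sided E s : Prop := limit_point (E `&` [set y | s < y]) s.

Definition rightmost T a : Prop := rtop T a = len T.

(* The new right endpoint c. In [tail_right] and [tail_left] the bottom
   singularities play against the rightmost top interval. *)
Definition tail_right T c : Prop :=
  [/\ ~ acc_max T (len T), ~ acc_max (inv_iet T) (len T),
      acc_max (inv_iet T) c, right_sided (sbot T) c &
      exists2 a, rightmost T a & top T a c].

Definition tail_left T c : Prop :=
  acc_max (inv_iet T) (len T) /\
  exists2 a, rightmost T a & is_min (sbot T `&` top T a) c.

Definition two_intervals T c : Prop :=
  [/\ ~ acc_max T (len T), ~ acc_max (inv_iet T) (len T),
      ~ (exists c', tail_right T c'), ~ (exists c', tail_right (inv_iet T) c') &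
      exists a b, [/\ rightmost T a, rightmost (inv_iet T) b &
                      c = Num.max (ltop T a) (lbot T b)]].

Definition cut T c : Prop :=
  [\/ tail_right T c \/ tail_right (inv_iet T) c,
      tail_left T c \/ tail_left (inv_iet T) c |
      two_intervals T c].

Definition renormalizable T : Prop :=
  [/\ ~ (acc_max T (len T) /\ acc_max (inv_iet T) (len T)),
      ~ (acc_min T 0 /\ acc_min (inv_iet T) 0) &
      exists2 c, cut T c & ~ (stop T c /\ sbot T c)].

Definition new_len T : R := xget 0 [set c | cut T c].

Definition winner_top T c w : Prop := rightmost T w /\ top T w c.

Definition winner T c w : Prop := winner_top T c w \/ winner_top (inv_iet T) c w.

Definition top_wins T c : Prop := exists w, winner_top T c w.
Definition bottom_wins T c : Prop := top_wins (inv_iet T) c.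

Definition loser T c g : Prop :=
  (top_wins T c /\ bot T g `<=` `[c, len T]) \/
  (bottom_wins T c /\ top T g `<=` `[c, len T]).

Definition new_top T c g : set R :=
  if `[< top_wins T c >] then top T g `&` `[0, c]
  else if `[< loser T c g >] then iinv T @` top T g
  else iinv T @` (bot T g `&` `[0, c]).

Definition return_map T c g : R -> R :=
  if `[< loser T c g >] then imap T \o imap T else imap T.

(* One step of the induction. The sets [new_top T c g] may contain c or its
   preimage; the new intervals are the open intervals with the same
   endpoints. *)
Definition rauzy T : iet R A :=
  let c := new_len T in
  Iet c
    (fun g => inf (new_top T c g))
    (fun g => sup (new_top T c g))
    (fun g => inf (return_map T c g @` new_top T c g))
    (fun g => sup (return_map T c g @` new_top T c g)).

Definition rauzy_iter (n : nat) T : iet R A := iter n rauzy T.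

Definition infinitely_renormalizable T : Prop :=
  forall n : nat, renormalizable (rauzy_iter n T).

Definition idmx : A -> A -> int := fun a b => (a == b)%:R.

(* Sums of finite support; all the sums formed in [rauzy_prod] are such, as
   the columns of the right factor have finite support. *)
Definition prodmx (M N : A -> A -> int) : A -> A -> int :=
  fun a b => \sum_(g \in [set: A]) (M a g * N g b).

(* The matrix of the first induction step of T. *)
Definition rauzy_step_matrix T : A -> A -> int :=
  fun a b => idmx a b +
    `[< winner T (new_len T) a /\ loser T (new_len T) b >]%:R.

(* The matrix of the n-th induction step, n >= 1. *)
Definition rauzy_matrix T (n : nat) : A -> A -> int :=
  rauzy_step_matrix (rauzy_iter n.-1 T).

Definition rauzy_prod T (m n : nat) : A -> A -> int :=
  \big[prodmx/idmx]_(m <= i < n.+1) rauzy_matrix T i.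

Definition combinatorially_minimal T : Prop :=
  forall (a b : A) (k : nat), (0 < k)%N ->
    exists2 n : nat, (0 < n)%N & 0 < rauzy_prod T k (k + n) a b.

End IET.

(* Main.v *)
From mathcomp Require Import all_boot all_order all_algebra.
From mathcomp Require Import all_classical all_reals all_analysis.
From mathcomp Require Import ring lra zify.
Require Import Defs.

Set Implicit Arguments.
Unset Strict Implicit.
Unset Printing Implicit Defensive.

Import Order.TTheory GRing.Theory Num.Theory.
Import numFieldNormedType.Exports.

Local Open Scope classical_set_scope.
Local Open Scope ring_scope.

(* Towers: the column of label b in M^(k,n) counts the visits, under T^(k-1),
   of the orbit of the n-th base interval b to the top intervals before it
   returns. As all entries are nonnegative, a positive entry (a, b) means that
   the tower over b goes through a.

   Suppose T combinatorially minimal. Each time the tower over b goes through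
   a <> b, an interval as long as the base b is cut off from a; hence all base
   lengths tend to 0, and so does their sum, the length of the domain, since the
   total length of the bases outside a finite set of labels is small from the
   start and does not increase. An invariant set F meets
   every shrinking domain, hence the interval adjacent to 0, which by condition
   (ii) is a top or a bottom interval keeping its label forever; by
   combinatorial minimality F meets all the bases, so all the levels of the
   towers, which are short: F is dense. This holds for all orbits, finite ones
   included.

   Conversely, if T is minimal without connections, each infinite half-orbit is
   dense: a limit point of it in the interior has an infinite orbit of limit
   points, while near an end point either T or its inverse is a translation.
   If the lengths decreased to L > 0, one of the half-orbits of L would be
   infinite and come back to the left of L without singularities, so that from
   some step on the same side, hence the same label, would always win. Then
   the losers jump by a fixed amount, the singularities just to the right of L
   never move and accumulate at L, and the rule for tails would cut at L. So
   the lengths tend to 0. Finally, the tower over b at a late step follows the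
   orbit of a point close to an end point of b on its right for as long as this
   orbit stays away from 0, so it goes through a by density. *)

(** * Intervals and singularities *)

Section RealLine.
Variable R : realType.
Implicit Types (E D : set R) (p q x : R).

(** A countable set is Lebesgue null, whereas the interval has measure [q - p]. *)
Lemma countable_avoid D p q : countable D -> p < q ->
  exists2 x, p < x < q & ~ D x.
Proof.
move=> cD pq; apply: contrapT => nex.
have sub : [set` `]p, q[ ] `<=` D.
  move=> x /=; rewrite in_itv /= => xpq; apply: contrapT => Dx.
  by apply: nex; exists x.
have /countable_lebesgue_measure0 : countable [set` `]p, q[ ].
  by apply: sub_countable cD; exact: subset_card_le.
rewrite lebesgue_measure_itv /= lte_fin pq -EFinD => -[].
by lra.
Qed.

Lemma limit_ptP E x : limit_point E x <->
  forall e, 0 < e -> exists y, [/\ y != x, E y & `|y - x| < e].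
Proof.
split=> [xE e e0|xE U /nbhs_ballP[e e0 sU]].
  have [y [yx Ey By]] := xE _ (nbhsx_ballx x e e0).
  by exists y; split=> //; rewrite distrC.
have [y [yx Ey xy]] := xE _ e0.
by exists y; split=> //; apply: sU; rewrite /ball /= distrC.
Qed.

End RealLine.

Section Basics.
Variables (R : realType) (A : countType).
Implicit Types (T : iet R A) (a b g w : A) (c s x y : R).

Lemma inv_ietK T : inv_iet (inv_iet T) = T.
Proof. by case: T. Qed.

Lemma is_iet_inv T : is_iet T -> is_iet (inv_iet T).
Proof.
by case=> l0 tT bT e; split=> //; move=> a; rewrite -e.
Qed.

Lemma topE T a x : top T a x = (ltop T a < x < rtop T a) :> Prop.
Proof. by rewrite /top /= in_itv. Qed.

Lemma botE T a x : bot T a x = (lbot T a < x < rbot T a) :> Prop.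
Proof. by rewrite /bot topE. Qed.

Lemma domE T x : dom T x = (0 <= x <= len T) :> Prop.
Proof. by rewrite /dom /= in_itv. Qed.

Lemma stop_itv T x : stop T x -> 0 <= x <= len T.
Proof. by case; rewrite domE. Qed.

Lemma stopN_top T a x : top T a x -> ~ stop T x.
Proof. by move=> ax [_]; apply; exists a. Qed.

Lemma stopN T x : 0 <= x <= len T -> ~ stop T x -> exists a, top T a x.
Proof.
move=> xT nx; have [|nax] := pselect (exists a, top T a x) => //.
by case: nx; split; [rewrite domE|case=> a _ ax; apply: nax; exists a].
Qed.

Lemma top_len T a : is_iet T -> 0 <= ltop T a /\ rtop T a <= len T.
Proof.
case=> l0 [lr dm _ _] _ _; split; rewrite leNgt; apply/negP => h.
- pose x := ltop T a + Num.min (rtop T a - ltop T a) (- ltop T a) / 2.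
  have ltr_ab := lr a; have : top T a x.
    by rewrite topE /x; case: (leP (rtop T a - ltop T a) (- ltop T a)) => ?; lra.
  move/(dm a); rewrite domE /x.
  by case: (leP (rtop T a - ltop T a) (- ltop T a)) => ?; lra.
- pose x := rtop T a - Num.min (rtop T a - ltop T a) (rtop T a - len T) / 2.
  have ltr_ab := lr a; have : top T a x.
    by rewrite topE /x; case: (leP (rtop T a - ltop T a) (rtop T a - len T)) => ?; lra.
  move/(dm a); rewrite domE /x.
  by case: (leP (rtop T a - ltop T a) (rtop T a - len T)) => ?; lra.
Qed.

Lemma top_itv T a x : is_iet T -> top T a x -> 0 < x < len T.
Proof. by move=> /(top_len a)[? ?]; rewrite topE; lra. Qed.

Lemma bot_itv T a x : is_iet T -> bot T a x -> 0 < x < len T.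
Proof. by move=> /is_iet_inv/top_itv; apply. Qed.

Lemma stop0 T : is_iet T -> stop T 0.
Proof.
move=> hT; split; first by case: hT => *; rewrite domE; lra.
by case=> a _ /(top_itv hT); lra.
Qed.

Lemma stopl T : is_iet T -> stop T (len T).
Proof.
move=> hT; split; first by case: hT => *; rewrite domE; lra.
by case=> a _ /(top_itv hT); lra.
Qed.

Lemma top_lt T a : is_iet T -> ltop T a < rtop T a.
Proof. by case=> _ []. Qed.

Lemma bot_lt T a : is_iet T -> lbot T a < rbot T a.
Proof. by move=> /is_iet_inv/top_lt; apply. Qed.

Lemma top_inj T a b x : is_iet T -> top T a x -> top T b x -> a = b.
Proof. by case=> _ [_ _ tI _] _ _ ax bx; apply: (tI a b) => //; exists x. Qed.

Lemma bot_inj T a b x : is_iet T -> bot T a x -> bot T b x -> a = b.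
Proof. by move=> /is_iet_inv/top_inj; apply. Qed.

Lemma width T a : is_iet T -> rbot T a = lbot T a + (rtop T a - ltop T a).
Proof. by case=> _ _ _ /(_ a) ->; ring. Qed.

Lemma imapE T a x : is_iet T -> top T a x ->
  imap T x = x + (lbot T a - ltop T a).
Proof.
move=> hT ax; rewrite /imap; case: xgetP => [y _ [b bx ->]|/(_ (x + (lbot T a - ltop T a)))].
  by rewrite (top_inj hT bx ax).
by case; exists a.
Qed.

Lemma iinvE T a x : is_iet T -> bot T a x ->
  iinv T x = x + (ltop T a - lbot T a).
Proof. by move=> /is_iet_inv hT ax; rewrite /iinv (imapE hT ax). Qed.

Lemma imap_bot T a x : is_iet T -> top T a x -> bot T a (imap T x).
Proof.
move=> hT ax; rewrite (imapE hT ax); move: ax; rewrite topE botE (width a hT); lra.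
Qed.

Lemma iinv_top T a x : is_iet T -> bot T a x -> top T a (iinv T x).
Proof.
by move=> hT ax; have := imap_bot (is_iet_inv hT) ax; rewrite /bot inv_ietK.
Qed.

Lemma imapK T a x : is_iet T -> top T a x -> iinv T (imap T x) = x.
Proof.
move=> hT ax; rewrite (iinvE hT (imap_bot hT ax)) (imapE hT ax); ring.
Qed.

Lemma iinvK T a x : is_iet T -> bot T a x -> imap T (iinv T x) = x.
Proof.
move=> hT ax; rewrite (imapE hT (iinv_top hT ax)) (iinvE hT ax); ring.
Qed.

Lemma sbotN_bot T a x : bot T a x -> ~ sbot T x.
Proof. exact: stopN_top. Qed.

Lemma sbotN T x : 0 <= x <= len T -> ~ sbot T x -> exists a, bot T a x.
Proof. exact: (@stopN (inv_iet T)). Qed.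

Lemma lbot_itv T a : is_iet T -> 0 <= lbot T a < len T.
Proof.
move=> hT; have := top_len a (is_iet_inv hT); have /= := bot_lt a hT; lra.
Qed.

Lemma ltop_itv T a : is_iet T -> 0 <= ltop T a < len T.
Proof. move=> hT; have := top_len a hT; have := top_lt a hT; lra. Qed.

(* If the left endpoint of one interval were inside another, the two would
   overlap to its right. *)
Lemma stop_ltop T a : is_iet T -> stop T (ltop T a).
Proof.
move=> hT; have := ltop_itv a hT => ha; have ha' := top_lt a hT.
split; first by rewrite domE; lra.
case=> b _; rewrite topE => hb.
pose x := ltop T a + Num.min (rtop T a - ltop T a) (rtop T b - ltop T a) / 2.
have [ax bx] : top T a x /\ top T b x.
  rewrite !topE /x; case: (leP (rtop T a - ltop T a) (rtop T b - ltop T a)) => ?; lra.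
have ba := top_inj hT bx ax.
by rewrite ba in hb; lra.
Qed.

Lemma stop_rtop T a : is_iet T -> stop T (rtop T a).
Proof.
move=> hT; have := top_len a hT => ha; have ha' := top_lt a hT.
split; first by rewrite domE; lra.
case=> b _; rewrite topE => hb.
pose x := rtop T a - Num.min (rtop T a - ltop T a) (rtop T a - ltop T b) / 2.
have [ax bx] : top T a x /\ top T b x.
  rewrite !topE /x; case: (leP (rtop T a - ltop T a) (rtop T a - ltop T b)) => ?; lra.
have ba := top_inj hT bx ax.
by rewrite ba in hb; lra.
Qed.

Lemma sbot_lbot T a : is_iet T -> sbot T (lbot T a).
Proof. by move=> /is_iet_inv/stop_ltop; apply. Qed.

Lemma top_le T a s : is_iet T -> stop T s -> ltop T a < s -> rtop T a <= s.
Proof.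
move=> hT ss ls; rewrite leNgt; apply/negP => lt.
by apply: (@stopN_top T a s) => //; rewrite topE ls lt.
Qed.

Lemma bot_le T a s : is_iet T -> sbot T s -> lbot T a < s -> rbot T a <= s.
Proof. by move=> /is_iet_inv/top_le; apply. Qed.

(** Otherwise every point of the interval is a singularity, hence an accumulation point of
    singularities, and there are only finitely many of these. *)
Lemma top_dense T p q : is_iet T -> 0 <= p -> p < q -> q <= len T ->
  exists a x, p < x < q /\ top T a x.
Proof.
move=> hT p0 pq ql; apply: contrapT => nex.
have st x : p < x < q -> stop T x.
  move=> hx; apply: contrapT => /stopN[|a ax]; first lra.
  by apply: nex; exists a, x.
have [x xpq] : exists2 x, p < x < q & ~ limit_point (stop T) x.
  apply: countable_avoid => //; apply: finite_set_countable.
  by case: hT => _ [].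
apply; apply/limit_ptP => e e0.
exists (x + Num.min e (q - x) / 2).
by case: (leP e (q - x)) => ?; split; try apply: st; try lra;
  rewrite addrC addKr ger0_norm; lra.
Qed.

End Basics.

(** * One step of the induction in closed form *)

(** Meant for [new_top] and its images, which may or may not contain their end points. *)
Lemma inf_sup_interval (R : realType) (E : set R) p q : p < q ->
  (forall x, E x -> p <= x <= q) -> (forall x, p < x < q -> E x) ->
  inf E = p /\ sup E = q.
Proof.
move=> pq sub sup; have Em : E ((p + q) / 2) by apply: sup; lra.
have hE : has_inf E by split; [exists ((p + q) / 2)|exists p => x /sub; lra].
have hS : has_sup E by split; [exists ((p + q) / 2)|exists q => x /sub; lra].
split; apply/eqP; rewrite eq_le; apply/andP; split.
- rewrite leNgt; apply/negP => lt.
  pose x := p + Num.min (q - p) (inf E - p) / 2.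
  have Ex : E x by apply: sup; rewrite /x; case: (leP (q - p) (inf E - p)) => ?; lra.
  have := inf_lbound hE.2 Ex; rewrite /x.
  by case: (leP (q - p) (inf E - p)) => ?; lra.
- by apply: lb_le_inf => [|x /sub]; [exists ((p + q) / 2)|lra].
- by apply: ge_sup => [|x /sub]; [exists ((p + q) / 2)|lra].
- rewrite leNgt; apply/negP => lt.
  pose x := q - Num.min (q - p) (q - reals.sup E) / 2.
  have Ex : E x by apply: sup; rewrite /x; case: (leP (q - p) (q - reals.sup E)) => ?; lra.
  have := sup_ubound hS.2 Ex; rewrite /x.
  by case: (leP (q - p) (q - reals.sup E)) => ?; lra.
Qed.

(** * Accumulation points of sets of reals *)

Section LimitPoints.
Variable R : realType.
Implicit Types (E F : set R) (x d : R).

Lemma limit_pt_sub E F : E `<=` F -> limit_point E `<=` limit_point F.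
Proof.
move=> EF x /limit_ptP xE; apply/limit_ptP => e /xE[y [yx Ey xy]].
by exists y; split=> //; exact: EF.
Qed.

Lemma not_limit_pt E x : ~ limit_point E x ->
  exists2 e, 0 < e & forall y, E y -> `|y - x| < e -> y = x.
Proof.
move=> nE; apply: contrapT => nex; apply: nE; apply/limit_ptP => e e0.
apply: contrapT => ny; apply: nex; exists e => // y Ey xy.
by apply/eqP; apply: contrapT => yx; apply: ny; exists y; split=> //; apply/negP.
Qed.

Lemma limit_ptU E F x : limit_point (E `|` F) x ->
  limit_point E x \/ limit_point F x.
Proof.
move=> /limit_ptP xEF; apply: contrapT => /not_orP[nE nF].
have [e e0 He] := not_limit_pt nE; have [d d0 Hd] := not_limit_pt nF.
have [|y [/eqP yx EFy]] := xEF (Num.min e d); first by rewrite lt_min e0.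
rewrite lt_min => /andP[ye yd]; apply: yx.
by case: EFy => ?; [exact: He|exact: Hd].
Qed.

Lemma finite_limit_ptU E F : finite_set (limit_point E) ->
  finite_set (limit_point F) -> finite_set (limit_point (E `|` F)).
Proof.
move=> fE fF; apply: (@sub_finite_set _ _ (limit_point E `|` limit_point F)).
  exact: limit_ptU.
by rewrite finite_setU.
Qed.

Lemma finite_no_limit_pt E x : finite_set E -> ~ limit_point E x.
Proof.
move=> fE /limit_point_infinite_setP/(_ setT).
by rewrite setTI; case=> //; exact: filterT.
Qed.

Lemma finite_limit_pt E : finite_set E -> finite_set (limit_point E).
Proof.
move=> fE; suff -> : limit_point E = set0 by exact: finite_set0.
by apply/seteqP; split=> // x; exact: finite_no_limit_pt.
Qed.

Lemma finite_limit_pt_shift E d : finite_set (limit_point E) ->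
  finite_set (limit_point [set x | E (x - d)]).
Proof.
move=> fE; apply: sub_finite_set (finite_image (fun x => x + d) fE).
move=> x /limit_ptP xE; exists (x - d); last by rewrite subrK.
apply/limit_ptP => e /xE[y [yx Ey xy]]; exists (y - d); split=> //.
  by apply: contra yx => /eqP/addIr ->.
by rewrite (_ : y - d - (x - d) = y - x)//; ring.
Qed.

End LimitPoints.

Section Step.
Variables (R : realType) (A : countType).
Implicit Types (T : iet R A) (a b g w : A) (c s x y : R).

Lemma ltop_inj T a b : is_iet T -> ltop T a = ltop T b -> a = b.
Proof.
move=> hT e; have la := top_lt a hT; have lb := top_lt b hT.
pose x := ltop T a + Num.min (rtop T a - ltop T a) (rtop T b - ltop T a) / 2.
apply: (@top_inj _ _ T a b x) => //; rewrite topE /x.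
  by case: (leP (rtop T a - ltop T a) (rtop T b - ltop T a)) => ?; lra.
by case: (leP (rtop T a - ltop T a) (rtop T b - ltop T a)) => ?; lra.
Qed.

Lemma rightmost_sep T a b : is_iet T -> rightmost T a -> b <> a ->
  rtop T b <= ltop T a.
Proof.
move=> hT ra ba; have la := top_lt a hT; have lb := top_lt b hT.
have sb := stop_ltop b hT; have sa := stop_ltop a hT.
case: (ltgtP (ltop T b) (ltop T a)) => [h|h|/(ltop_inj hT)//].
  exact: top_le.
by have := top_le hT sb h; have := ltop_itv b hT; rewrite ra; lra.
Qed.

Lemma rightmost_inj T a b : is_iet T -> rightmost T a -> rightmost T b -> a = b.
Proof.
move=> hT ra rb; apply: contrapT => /(rightmost_sep hT rb).
by have := ltop_itv b hT; rewrite ra; lra.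
Qed.

(** [stop T] is closed: points outside the domain or inside a top interval have neighbourhoods free
    of singularities. *)
Lemma limit_stop T s : is_iet T -> limit_point (stop T) s -> stop T s.
Proof.
move=> hT /limit_ptP ls; apply: contrapT => ns.
have s0 : 0 <= s.
  rewrite leNgt; apply/negP => s0; have [|y [_ /stop_itv hy]] := ls (- s); first lra.
  by rewrite ltr_norml; lra.
have sl : s <= len T.
  rewrite leNgt; apply/negP => sl; have [|y [_ /stop_itv hy]] := ls (s - len T); first lra.
  by rewrite ltr_norml; lra.
have [|a sa] := stopN _ ns; first lra; move: (sa); rewrite topE => ha.
have [|y [_ sy]] := ls (Num.min (s - ltop T a) (rtop T a - s)).
  by case: (leP (s - ltop T a) (rtop T a - s)) => ?; lra.
rewrite ltr_norml => hy; apply: (@stopN_top _ _ T a y) => //; rewrite topE.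
by move: hy; case: (leP (s - ltop T a) (rtop T a - s)) => ?; lra.
Qed.

(** Some top interval meets the gap to the right of [y]. Its left end is a singularity, so it is not
    in the gap; nor is it to the left of [y], since [y] is not inside the interval. *)
Lemma stop_isolated_right T y e : is_iet T -> stop T y -> y < len T -> 0 < e ->
  (forall z, stop T z -> y < z -> y + e <= z) -> exists a, ltop T a = y.
Proof.
move=> hT sy yl e0 He; have hy := stop_itv sy.
have [|||a [z [yz az]]] := @top_dense _ _ T y (Num.min (y + e) (len T)) hT.
- by lra.
- by rewrite lt_min; apply/andP; split; lra.
- by rewrite ge_min lexx orbT.
move: yz; rewrite lt_min => /andP[yz /andP[ze zl]].
exists a; apply/eqP; rewrite eq_le; apply/andP; split; rewrite leNgt; apply/negP.
  by move=> /(He _ (stop_ltop a hT)); move: az; rewrite topE; lra.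
by move=> /(top_le hT sy); move: az; rewrite topE; lra.
Qed.

Lemma stop_isolated_left T y e : is_iet T -> stop T y -> 0 < y -> 0 < e ->
  (forall z, stop T z -> z < y -> z <= y - e) -> exists a, rtop T a = y.
Proof.
move=> hT sy yl e0 He; have hy := stop_itv sy.
have [|||a [z [yz az]]] := @top_dense _ _ T (Num.max (y - e) 0) y hT.
- by rewrite le_max lexx orbT.
- by rewrite gt_max; apply/andP; split; lra.
- by lra.
move: yz; rewrite gt_max => /andP[/andP[ze zl] yz].
exists a; apply/eqP; rewrite eq_le; apply/andP; split; rewrite leNgt; apply/negP.
  move=> ya; apply: (@stopN_top _ _ T a y) => //.
  by move: az; rewrite !topE; lra.
by move=> /(He _ (stop_rtop a hT)); move: az; rewrite topE; lra.
Qed.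

Lemma leftmostP T : is_iet T -> ~ limit_point (stop T) 0 ->
  exists a, ltop T a = 0.
Proof.
move=> hT /not_limit_pt[e e0 He]; have l0 : 0 < len T by case: hT.
apply: (stop_isolated_right hT (stop0 hT) l0 e0) => z sz z0.
rewrite leNgt; apply/negP => ze; have := He _ sz.
by rewrite subr0 ger0_norm; lra.
Qed.

Lemma rightmostP T : is_iet T -> ~ limit_point (stop T) (len T) ->
  exists a, rightmost T a.
Proof.
move=> hT /not_limit_pt[e e0 He]; have l0 : 0 < len T by case: hT.
apply: (stop_isolated_left hT (stopl hT) l0 e0) => z sz zl.
rewrite leNgt; apply/negP => ze; have := He _ sz.
by rewrite ler0_norm; lra.
Qed.

Lemma rightmost_noacc T a : is_iet T -> rightmost T a ->
  ~ limit_point (stop T) (len T).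
Proof.
move=> hT ra /limit_ptP/(_ (len T - ltop T a)); have hl := ltop_itv a hT.
case=> [|y [yl sy]]; first lra.
rewrite ltr_norml => hy; have yT := stop_itv sy.
have yl' : y < len T by rewrite lt_neqAle yl; lra.
by apply: (@stopN_top _ _ T a y) => //; rewrite topE ra; lra.
Qed.

Lemma is_max_unique (E : set R) x y : is_max E x -> is_max E y -> x = y.
Proof.
by move=> [Ex ux] [Ey uy]; have := ux _ Ey; have := uy _ Ex; lra.
Qed.

Lemma is_min_unique (E : set R) x y : is_min E x -> is_min E y -> x = y.
Proof.
by move=> [Ex ux] [Ey uy]; have := ux _ Ey; have := uy _ Ex; lra.
Qed.

(** The top singularity [c'] cannot be inside [top T a], which contains [c] and ends at [len T]; so
    [c' < c], and [c < c'] by symmetry. *)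
Lemma tail_right_excl T c c' : is_iet T ->
  tail_right T c -> tail_right (inv_iet T) c' -> False.
Proof.
move=> hT [_ _ [lc _] _ [a ra ca]] [_ _ [lc' _] _ [b rb cb]].
have sc := limit_stop (is_iet_inv hT) lc.
have sc' := limit_stop hT lc'.
move: ca cb; rewrite !topE => ca cb.
have h1 : c' <= ltop T a.
  rewrite leNgt; apply/negP => h; have := top_le hT sc' h.
  by rewrite ra; move: cb; rewrite rb /=; lra.
have h2 : c <= lbot T b.
  rewrite leNgt; apply/negP => h; have := top_le (is_iet_inv hT) sc h.
  by rewrite rb /=; move: ca; rewrite ra; lra.
by move: ca cb => /=; lra.
Qed.

(** For two cuts by the same rule, maxima, minima and rightmost labels are unique. Different rules
    are incompatible: [tail_left] needs accumulation at [len T] on one side, which all other rules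
    forbid. *)
Lemma cut_unique T c c' : is_iet T -> cut T c -> cut T c' -> c = c'.
Proof.
move=> hT.
have hI := is_iet_inv hT.
have TLI x y : tail_left T x -> tail_left (inv_iet T) y -> False.
  move=> [[al _] _] [_ [b rb _]].
  exact: (rightmost_noacc hI rb).
move=> [[h|h]|[h|h]|h] [[h'|h']|[h'|h']|h'].
- by case: h h' => _ _ m _ _ [_ _ m' _ _]; exact: is_max_unique m m'.
- by case: (tail_right_excl hT h h').
- by case: h h' => _ h _ _ _ [/h].
- by case: h h' => h _ _ _ _ [/h].
- by case: h' => _ _ []; exists c.
- by case: (tail_right_excl hT h' h).
- by case: h h' => _ _ m _ _ [_ _ m' _ _]; exact: is_max_unique m m'.
- by case: h h' => h _ _ _ _ [/h].
- by case: h h' => _ h _ _ _ [/h].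
- by case: h' => _ _ _ []; exists c.
- by case: h' h => _ h _ _ _ [/h].
- by case: h' h => h _ _ _ _ [/h].
- case: h h' => _ [a ra m] [_ [b rb m']].
  by rewrite (rightmost_inj hT rb ra) in m'; exact: is_min_unique m m'.
- by case: (TLI _ _ h h').
- by case: h' h => _ h _ _ _ [/h].
- by case: h' h => h _ _ _ _ [/h].
- by case: h' h => _ h _ _ _ [/h].
- by case: (TLI _ _ h' h).
- case: h h' => _ [a ra m] [_ [b rb m']].
  by rewrite (rightmost_inj hI rb ra) in m'; exact: is_min_unique m m'.
- by case: h' h => h _ _ _ _ [/h].
- by case: h => _ _ []; exists c'.
- by case: h => _ _ _ []; exists c'.
- by case: h h' => _ h _ _ _ [/h].
- by case: h h' => h _ _ _ _ [/h].
- case: h h' => _ _ _ _ [a [b [ra rb ->]]] [_ _ _ _ [a' [b' [ra' rb' ->]]]].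
  by rewrite (rightmost_inj hT ra ra') (rightmost_inj hI rb rb').
Qed.

Lemma cut_inv T c : cut (inv_iet T) c -> cut T c.
Proof.
move=> [[h|h]|[h|h]|h].
- by apply: Or31; right.
- by apply: Or31; left; rewrite inv_ietK in h.
- by apply: Or32; right.
- by apply: Or32; left; rewrite inv_ietK in h.
- apply: Or33; case: h; rewrite inv_ietK => h1 h2 h3 h4 [a [b [ra rb ->]]].
  by split=> //; exists b, a; rewrite maxC.
Qed.

Lemma new_len_inv T : new_len (inv_iet T) = new_len T.
Proof.
rewrite /new_len; congr xget; apply/seteqP; split => c /= h; first exact: cut_inv.
by apply: cut_inv; rewrite inv_ietK.
Qed.

Lemma renormalizable_inv T : renormalizable T -> renormalizable (inv_iet T).
Proof.
move=> [h1 h2 [c cc h3]]; split; rewrite ?inv_ietK.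
- by move=> [? ?]; apply: h1.
- by move=> [? ?]; apply: h2.
- exists c; first by apply: cut_inv; rewrite inv_ietK.
  by move=> [s1 s2]; apply: h3; split=> //; rewrite /sbot inv_ietK in s2.
Qed.

(* The top interval w wins with the cut at c; [topcase (inv_iet T) c w] says
   that the bottom interval w does. *)
Definition topcase T c w : Prop := [/\ rightmost T w, top T w c & sbot T c].

(** A tail cuts at a singularity of its own side, inside the rightmost interval of the other. Two
    intervals cut at the larger left end point; if both were equal, this would be a singularity on
    both sides. *)
Lemma topcaseP T : is_iet T -> renormalizable T ->
  (exists w, topcase T (new_len T) w) \/
  (exists w, topcase (inv_iet T) (new_len T) w).
Proof.
move=> hT [_ _ [c cc nst]].
have hI := is_iet_inv hT.
have -> : new_len T = c.
  by apply: xget_unique => // y /= cy; exact: cut_unique cy cc.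
case: cc => [[[_ _ m _ [a ra ca]]|[_ _ m _ [a ra ca]]]|[[_ [a ra [[sc ca] _]]]|[_ [a ra [[sc ca] _]]]]|].
- by left; exists a; split=> //; exact: limit_stop m.1.
- by right; exists a; split=> //; apply: limit_stop hT m.1.
- by left; exists a.
- by right; exists a.
- move=> [_ _ _ _ [a [b [ra rb cE]]]].
  have la := ltop_itv a hT; have lb := lbot_itv b hT.
  have sa := stop_ltop a hT; have sb := sbot_lbot b hT.
  case: (ltgtP (ltop T a) (lbot T b)) cE => [h|h|h] cE.
  + by left; exists a; split; rewrite ?cE // topE ra; lra.
  + right; exists b; split; rewrite ?cE //; first by rewrite topE rb /=; lra.
  + by case: nst; rewrite cE; split=> //; rewrite h.
Qed.

Definition delta T w : R := lbot T w - ltop T w.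

(* The losers are the g with [c <= lbot T g]; they are translated along with the
   cut piece of [top T w]. *)
Definition topstep T c w : iet R A :=
  Iet c (ltop T)
    (fun g => if g == w then c else rtop T g)
    (fun g => if c <= lbot T g then lbot T g + delta T w else lbot T g)
    (fun g => (if c <= lbot T g then lbot T g + delta T w else lbot T g) +
       ((if g == w then c else rtop T g) - ltop T g)).

Section TopCase.
Variables (T : iet R A) (c : R) (w : A).
Hypotheses (hT : is_iet T) (tc : topcase T c w).

Lemma topcase_c : 0 < c < len T /\ ltop T w < c.
Proof.
case: tc => rw; rewrite topE rw => cw sc.
by have := ltop_itv w hT; lra.
Qed.

Lemma topcase_w : rtop T w = len T. Proof. by case: tc. Qed.

Lemma topcase_other g : g <> w -> rtop T g <= ltop T w.
Proof. by move=> gw; apply: rightmost_sep => //; case: tc. Qed.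

Lemma topcase_bot g : lbot T g < c -> rbot T g <= c.
Proof. by case: tc => _ _ sc; exact: bot_le. Qed.

(** The piece to the right of [c] is too short for [bot T w], which is as long as [top T w], an
    interval containing [c] and ending at [len T]. *)
Lemma topcase_nloser : lbot T w < c.
Proof.
rewrite ltNge; apply/negP => h; have := topcase_c; have := topcase_w.
have /= := top_len w (is_iet_inv hT); have := width w hT; lra.
Qed.

Lemma topcase_rbot : rbot T w <= c.
Proof. exact: topcase_bot topcase_nloser. Qed.

Lemma delta_lt0 : delta T w < 0.
Proof.
have := topcase_rbot; have := topcase_c; have := topcase_w.
have := width w hT; rewrite /delta; lra.
Qed.

Lemma loserP g : loser T c g <-> c <= lbot T g.
Proof.
have lg := bot_lt g hT; have [/= bl br] := top_len g (is_iet_inv hT).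
split=> [[[_ sub]|[[v [_ cv]] _]]|cg].
- rewrite leNgt; apply/negP => h; have h' := topcase_bot h.
  have /sub : bot T g ((lbot T g + rbot T g) / 2) by rewrite botE; lra.
  by rewrite /= in_itv /=; lra.
- by case: (@sbotN_bot _ _ T v c) => //; case: tc.
- left; split; first by exists w; case: tc.
  by move=> x; rewrite botE /= in_itv /=; lra.
Qed.

Lemma top_wins_topcase : top_wins T c.
Proof. by exists w; case: tc. Qed.

Lemma winner_topcase g : winner T c g <-> g = w.
Proof.
split=> [[[rg _]|[_ cg]]|->].
- by apply: (rightmost_inj hT rg); case: tc.
- by case: (@sbotN_bot _ _ T g c) => //; case: tc.
- by left; case: tc.
Qed.

(** The image of a loser lies to the right of [c], inside [top T w], so a second application of the
    map adds [delta T w]; other labels return at once. *)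
Lemma rauzy_topstep : c = new_len T -> rauzy T = topstep T c w.
Proof.
move=> cE; have [/andP[c0 cl] wc] := topcase_c; have rw := topcase_w.
have nt g : new_top T c g = top T g `&` `[0, c].
  by rewrite /new_top; case: asboolP => // h; case: h; exact: top_wins_topcase.
have ntE g x : new_top T c g x -> ltop T g <= x <= (if g == w then c else rtop T g).
  rewrite nt => -[]; rewrite topE /= in_itv /=.
  by case: eqVneq => _; lra.
have ntI g x : ltop T g < x < (if g == w then c else rtop T g) -> new_top T c g x.
  move=> h; have lg := ltop_itv g hT; have oth := @topcase_other g.
  rewrite nt; split; move: h; rewrite ?topE /= ?in_itv /=; case: eqVneq => [->|/eqP gw] h.
  - by rewrite rw; lra.
  - by [].
  - by have := ltop_itv w hT; lra.
  - by have := oth gw; have := ltop_itv w hT; lra.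
have ltw g : ltop T g < (if g == w then c else rtop T g).
  by case: eqVneq => [->//|_]; exact: top_lt.
have ntT g x : new_top T c g x -> top T g x by rewrite nt => -[].
have IS g := inf_sup_interval (ltw g) (ntE g) (ntI g).
have rm g x : top T g x -> return_map T c g x =
    x + (if c <= lbot T g then lbot T g + delta T w else lbot T g) - ltop T g.
  move=> gx; have gb := imap_bot hT gx; have gxE := imapE hT gx.
  rewrite /return_map; case: asboolP => [/loserP|/loserP/negP/negbTE] h.
    rewrite h /= (@imapE _ _ T w _ hT) gxE /delta; first by ring.
    move: gb; rewrite botE gxE topE rw.
    have /= := top_len g (is_iet_inv hT); lra.
  by rewrite h gxE; ring.
pose l' g := if c <= lbot T g then lbot T g + delta T w else lbot T g.
have IS' g : inf (return_map T c g @` new_top T c g) = l' g /\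
    sup (return_map T c g @` new_top T c g) =
    l' g + ((if g == w then c else rtop T g) - ltop T g).
  apply: inf_sup_interval.
  - by have := ltw g; lra.
  - move=> _ [x gx <-]; rewrite (rm _ _ (ntT _ _ gx)); have := ntE _ _ gx.
    by rewrite -/(l' g); lra.
  - move=> y hy; exists (y - l' g + ltop T g).
      by apply: ntI; lra.
    by rewrite rm; [rewrite -/(l' g); ring|apply: ntT; apply: ntI; lra].
rewrite /rauzy -cE /topstep; congr Iet; apply/funext => g.
- by case: (IS g).
- by case: (IS g).
- by case: (IS' g).
- by case: (IS' g).
Qed.


Lemma topstep_top g x : top (topstep T c w) g x <-> top T g x /\ x < c.
Proof.
have lw := topcase_c; have lg := ltop_itv w hT; have oth := @topcase_other g.
rewrite !topE /=; case: eqVneq => [->|/eqP/oth]; have := topcase_w; lra.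
Qed.

Lemma topstep_bot g x : bot (topstep T c w) g x <->
  [\/ c <= lbot T g /\ bot T g (x - delta T w),
      lbot T g < c /\ g <> w /\ bot T g x |
      g = w /\ lbot T w < x < lbot T w + (c - ltop T w)].
Proof.
have nl := topcase_nloser; have wg := width g hT.
have ww := width w hT; have := topcase_w.
rewrite !botE /=; case: eqVneq => [->|/eqP gw].
  rewrite leNgt nl /=; split=> [h|]; first by apply: Or33.
  by case=> [[]|[_ []]|[]].
case: (leP c (lbot T g)) => cg; split=> [h|].
- by apply: Or31; split=> //; lra.
- by case=> [[_ h]|[]|[]] //; lra.
- by apply: Or32; split=> //; split=> //; lra.
- by case=> [[]|[_ [_ h]]|[]] //; lra.
Qed.

(** The losers land in the part of [bot T w] freed by the shortening of [w]. *)
Lemma loser_shift g x : c <= lbot T g -> bot T g (x - delta T w) ->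
  bot T w x /\ lbot T w + (c - ltop T w) < x.
Proof.
move=> cg gx; have := bot_itv hT gx; move: gx; rewrite !botE /delta.
have := width w hT; have := topcase_w; have := topcase_c; lra.
Qed.

Lemma topstep_bot_lt g x : bot (topstep T c w) g x -> x < c.
Proof.
have rb := topcase_rbot; have cc := topcase_c.
have ww := width w hT; have rw := topcase_w.
case/topstep_bot => [[cg]|[gc [_]]|[_]].
- by move=> /(loser_shift cg)[+ _]; rewrite botE; lra.
- by have := topcase_bot gc; rewrite botE; lra.
- by lra.
Qed.

Lemma stop_topstep x : stop (topstep T c w) x -> stop T x \/ x = c.
Proof.
move=> sx; have := stop_itv sx => /= xc; have cc := topcase_c.
apply: contrapT => /not_orP[nsx xnc].
have [|a ax] := stopN _ nsx; first lra.
apply: (@stopN_top _ _ (topstep T c w) a x) => //; apply/topstep_top; split=> //.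
by rewrite lt_neqAle; apply/andP; split; [apply/eqP|lra].
Qed.

(** Serves to keep the accumulation points finite in number. A point of neither kind is in a new
    bottom interval: either its old one or that of the loser that now covers it. *)
Lemma sbot_topstep x : sbot (topstep T c w) x ->
  sbot T x \/ sbot T (x - delta T w).
Proof.
move=> sx; have := stop_itv sx => /= xc; have cc := topcase_c.
have sc : sbot T c by case: tc.
have hw := topcase_w; have ww := width w hT; have lw := ltop_itv w hT.
apply: contrapT => /not_orP[nsx nsd].
have [|a ax] := sbotN _ nsx; first lra.
have nb g : ~ bot (topstep T c w) g x by move/sbotN_bot.
have [ac|ca] := ltP (lbot T a) c; last first.
  have : x = c by move: ax; rewrite botE; lra.
  by move=> xE; apply: nsx; rewrite xE.
have [aw|aw] := pselect (a = w); last by apply: (nb a); apply/topstep_bot; apply: Or32.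
rewrite {}aw {a} in ax ac; move: ax; rewrite botE => ax.
have [|g gx] := @sbotN _ _ T (x - delta T w) _ nsd; first by rewrite /delta; lra.
have [h|h] := ltP x (lbot T w + (c - ltop T w)).
  by apply: (nb w); apply/topstep_bot; apply: Or33; split=> //; lra.
apply: (nb g); apply/topstep_bot; apply: Or31; split=> //.
rewrite leNgt; apply/negP => /topcase_bot; move: gx; rewrite botE /delta; lra.
Qed.

Lemma is_iet_topstep : is_iet (topstep T c w).
Proof.
have cc := topcase_c; split=> //=; first lra; last by move=> a; ring.
- split=> /=.
  + by move=> a; case: eqVneq => [->|_]; [lra|exact: top_lt].
  + by move=> a x /topstep_top[ax xc]; rewrite domE /=; have := top_itv hT ax; lra.
  + by move=> a b _ _ [x [/topstep_top[ax _] /topstep_top[bx _]]]; exact: top_inj ax bx.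
  + apply: (@sub_finite_set _ _ (limit_point (stop T `|` [set c]))).
      apply: limit_pt_sub => x /stop_topstep; exact.
    apply: finite_limit_ptU; last by apply: finite_limit_pt; exact: finite_set1.
    by case: hT => _ [].
- split=> /=.
  + move=> a; rewrite ltrDl subr_gt0.
    by case: eqVneq => [->|_]; [lra|exact: top_lt].
  + move=> a x h; have := topstep_bot_lt h; rewrite domE /=.
    case/topstep_bot: h => [[ca /(loser_shift ca)[+ _]]|[_ [_ ax]]|[_ ax]].
    * by move=> /(bot_itv hT); lra.
    * by have := bot_itv hT ax; lra.
    * by have := lbot_itv w hT; lra.
  + move=> a b _ _ [x [/topstep_bot ha /topstep_bot hb]].
    have ww := width w hT; have wr := topcase_w.
    have wI y : lbot T w < y < lbot T w + (c - ltop T w) -> bot T w y.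
      by rewrite botE; lra.
    case: ha => [[ca ax]|[ac [aw ax]]|[-> ax]]; case: hb => [[cb bx]|[bc [bw bx]]|[-> bx]].
    * exact: bot_inj ax bx.
    * by have [wx _] := loser_shift ca ax; case: bw; exact: bot_inj hT bx wx.
    * by exfalso; have [_] := loser_shift ca ax; lra.
    * by have [wx _] := loser_shift cb bx; case: aw; exact: bot_inj hT ax wx.
    * exact: bot_inj ax bx.
    * by case: aw; apply: bot_inj hT ax (wI _ bx).
    * by exfalso; have [_] := loser_shift cb bx; lra.
    * by case: bw; apply: bot_inj hT bx (wI _ ax).
    * by [].
  + apply: (@sub_finite_set _ _ (limit_point (sbot T `|` [set x | sbot T (x - delta T w)]))).
      apply: limit_pt_sub => x /sbot_topstep; exact.
    have hf : finite_set (limit_point (sbot T)) by case: hT => _ _ [].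
    apply: finite_limit_ptU => //; exact: finite_limit_pt_shift.
Qed.

End TopCase.

(** * The step won by a bottom interval *)

Section BottomCase.
Variables (T : iet R A) (c : R) (w : A).
Hypotheses (hT : is_iet T) (tc : topcase (inv_iet T) c w).

Let hI : is_iet (inv_iet T) := is_iet_inv hT.

Lemma loser_inv g : loser (inv_iet T) c g <-> loser T c g.
Proof.
by rewrite /loser /bottom_wins /bot inv_ietK; split=> -[]; [right|left|right|left].
Qed.

Lemma bottomcase_top_wins : ~ top_wins T c.
Proof.
by case=> v [_ cv]; case: tc => _ _; rewrite /sbot inv_ietK; exact: stopN_top cv.
Qed.

(** Here [rauzy] defines the new top intervals as preimages. Their end points turn out to be those
    of a step won by the top, with top and bottom exchanged. *)
Lemma rauzy_bottomstep : c = new_len T ->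
  rauzy T = inv_iet (topstep (inv_iet T) c w).
Proof.
move=> cE; have [/andP[c0 cl] wc] := topcase_c hI tc; have rw := topcase_w tc.
move: cl wc rw => /= cl wc rw.
have lP g : loser T c g <-> c <= ltop T g.
  by rewrite -loser_inv (loserP hI tc).
pose l' g := if c <= ltop T g then ltop T g + delta (inv_iet T) w else ltop T g.
pose r' g := if g == w then c else rbot T g.
have lr' g : lbot T g < r' g.
  by rewrite /r'; case: eqVneq => [->//|_]; exact: bot_lt.
have ntE g x : new_top T c g x <->
    if c <= ltop T g then exists2 y, top T g y & x = iinv T y
    else exists2 y, bot T g y /\ 0 <= y <= c & x = iinv T y.
  rewrite /new_top; case: asboolP => [/bottomcase_top_wins//|_].
  case: asboolP => [/lP ->|/lP/negP/negbTE ->]; split.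
  - by case=> y gy <-; exists y.
  - by case=> y gy ->; exists y.
  - by case=> y [gy]; rewrite /= in_itv => yc <-; exists y.
  - by case=> y [gy yc] ->; exists y => //; split => //; rewrite /= in_itv.
have lbw g y : c <= ltop T g -> top T g y -> bot T w y.
  move=> cg gy; have := top_itv hT gy; move: gy; rewrite topE botE; lra.
have bE g : [/\ forall y, lbot T g < y < r' g -> bot T g y /\ 0 <= y <= c &
       forall y, bot T g y /\ 0 <= y <= c -> lbot T g <= y <= r' g].
  have bg := lbot_itv g hT; have oth := topcase_other hI tc (g:=g).
  split=> y; rewrite botE /r'; case: eqVneq => [->|/eqP/oth /=]; have := lbot_itv w hT; lra.
have rtopE g : r' g - lbot T g = rbot T g - lbot T g \/ g = w.
  by rewrite /r'; case: eqVneq => [->|_]; [right|left].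
have wnl : (c <= ltop T w) = false.
  by apply/negbTE; rewrite -ltNge; exact: topcase_nloser hI tc.
have IS g : inf (new_top T c g) = l' g /\
    sup (new_top T c g) = l' g + (r' g - lbot T g).
  have [bI bO] := bE g.
  have wg := width g hT; have lrg := lr' g.
  apply: inf_sup_interval; first lra.
  - move=> x /ntE; rewrite /l'; case: ifP => cg [y].
      move=> gy ->; rewrite (iinvE hT (lbw _ _ cg gy)) /delta /=.
      move: gy; rewrite topE; case: (rtopE g) => [|gw]; first lra.
      by rewrite gw wnl in cg.
    by move=> gy ->; rewrite (iinvE hT gy.1); have := bO _ gy; lra.
  - move=> x; rewrite /l' => hx; apply/ntE; move: hx; case: ifP => cg hx.
      have gy : top T g (x - delta (inv_iet T) w).
        rewrite topE; case: (rtopE g) => [|gw]; first lra.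
        by rewrite gw wnl in cg.
      exists (x - delta (inv_iet T) w) => //.
      by rewrite (iinvE hT (lbw _ _ cg gy)) /delta /=; ring.
    have gy := bI (x - ltop T g + lbot T g) ltac:(lra).
    by exists (x - ltop T g + lbot T g) => //; rewrite (iinvE hT gy.1); ring.
have IS' g : inf (return_map T c g @` new_top T c g) = lbot T g /\
    sup (return_map T c g @` new_top T c g) = r' g.
  have [bI bO] := bE g.
  have wg := width g hT; have lrg := lr' g.
  have rm x y : (if c <= ltop T g then top T g y else bot T g y) ->
      x = iinv T y ->
      return_map T c g x = if c <= ltop T g then y + (lbot T g - ltop T g) else y.
    rewrite /return_map; case: asboolP => [/lP cg|/lP/negP/negbTE cg]; rewrite cg => gy ->.
      by rewrite /= (iinvK hT (lbw _ _ cg gy)) (imapE hT gy).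
    by rewrite (iinvK hT gy).
  apply: inf_sup_interval => //.
  - move=> _ [x /ntE gx <-]; move: gx rm; case: ifP => cg [y gy xE] rm.
      rewrite (rm _ _ gy xE); move: gy; rewrite topE; case: (rtopE g) => [|gw]; first lra.
      by rewrite gw wnl in cg.
    by rewrite (rm _ _ gy.1 xE); exact: bO.
  - move: rm (ntE g) => + + y hy; case: (boolP (c <= ltop T g)) => cg rm ntE'.
      have gy : top T g (y - (lbot T g - ltop T g)).
        rewrite topE; case: (rtopE g) => [|gw]; first lra.
        by rewrite gw wnl in cg.
      exists (iinv T (y - (lbot T g - ltop T g))).
        by apply/ntE'; exists (y - (lbot T g - ltop T g)).
      by rewrite (rm _ _ gy erefl); ring.
    have gy := bI y hy; exists (iinv T y); first by apply/ntE'; exists y.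
    by rewrite (rm _ _ gy.1 erefl).
rewrite /rauzy -cE /topstep /inv_iet /=; congr Iet; apply/funext => g.
- by case: (IS g).
- by case: (IS g).
- by case: (IS' g).
- by case: (IS' g).
Qed.

End BottomCase.

Lemma rauzyP T : is_iet T -> renormalizable T ->
  (exists c w, [/\ topcase T c w, c = new_len T & rauzy T = topstep T c w]) \/
  (exists c w, [/\ topcase (inv_iet T) c w, c = new_len T &
     rauzy T = inv_iet (topstep (inv_iet T) c w)]).
Proof.
move=> hT /(topcaseP hT)[[w tc]|[w tc]].
  by left; exists (new_len T), w; split=> //; exact: rauzy_topstep.
by right; exists (new_len T), w; split=> //; exact: rauzy_bottomstep.
Qed.

Lemma is_iet_rauzy T : is_iet T -> renormalizable T -> is_iet (rauzy T).
Proof.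
move=> hT /(rauzyP hT)[[c [w [tc _ ->]]]|[c [w [tc _ ->]]]].
  exact: is_iet_topstep.
by apply: is_iet_inv; apply: is_iet_topstep => //; exact: is_iet_inv.
Qed.

(** By this symmetry, later facts about the inverse follow from those about [T]. *)
Lemma rauzy_inv T : is_iet T -> renormalizable T ->
  rauzy (inv_iet T) = inv_iet (rauzy T).
Proof.
move=> hT /(rauzyP hT)[[c [w [tc cE ->]]]|[c [w [tc cE ->]]]].
  rewrite (@rauzy_bottomstep (inv_iet T) c w) ?new_len_inv ?inv_ietK //.
  exact: is_iet_inv.
rewrite (@rauzy_topstep (inv_iet T) c w) ?new_len_inv ?inv_ietK //.
exact: is_iet_inv.
Qed.

End Step.

(** * The induced map of one step *)

Section Dynamics.
Variables (R : realType) (A : countType).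
Implicit Types (T : iet R A) (a b g w : A) (c s x y : R).

(* T' is the first return map of T to [0, len T'], the return times being 1 and
   2, and it has no other singularities than those forced by T. *)
Definition first_return T T' : Prop :=
  [/\ forall y, 0 < y < len T' -> ~ stop T y -> imap T y < len T' ->
        ~ stop T' y /\ imap T' y = imap T y,
      forall y, 0 < y < len T' -> ~ stop T y -> len T' <= imap T y ->
        ~ stop T (imap T y) ->
        [/\ ~ stop T' y, imap T' y = imap T (imap T y) &
            imap T (imap T y) < len T'],
      forall y, 0 < y < len T' -> ~ stop T' y ->
        ~ stop T y /\
        (imap T y < len T' \/ (len T' <= imap T y /\ ~ stop T (imap T y))) &
      forall y, len T' <= y < len T -> ~ stop T y -> imap T y < len T'].

Lemma stopN_itv T x : is_iet T -> 0 < x < len T -> ~ stop T x ->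
  exists a, top T a x.
Proof. by move=> hT xl; apply: stopN; lra. Qed.

Section TopDynamics.
Variables (T : iet R A) (c : R) (w : A).
Hypotheses (hT : is_iet T) (tc : topcase T c w).
Let T' := topstep T c w.
Let hT' : is_iet T' := is_iet_topstep hT tc.

Lemma topstep_imap_loser g x : c <= lbot T g -> top T' g x ->
  [/\ top T g x, c < imap T x, top T w (imap T x) & imap T' x = imap T (imap T x)].
Proof.
move=> cg gx; have /(topstep_top hT tc)[gx' xc] := gx.
have bx := imap_bot hT gx'; have bl := bot_itv hT bx.
have cx : c < imap T x by move: bx; rewrite botE; lra.
have lw := topcase_c hT tc; have rw := topcase_w tc.
have wx : top T w (imap T x) by rewrite topE rw; lra.
split=> //; rewrite (imapE hT' gx) (imapE hT wx) (imapE hT gx') /= cg /delta.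
by ring.
Qed.

Lemma topstep_imap_nloser g x : lbot T g < c -> top T' g x ->
  [/\ top T g x, imap T x < c & imap T' x = imap T x].
Proof.
move=> gc gx; have /(topstep_top hT tc)[gx' xc] := gx.
have bx := imap_bot hT gx'; split=> //.
  by have := topcase_bot hT tc gc; move: bx; rewrite botE; lra.
by rewrite (imapE hT' gx) (imapE hT gx') /= leNgt gc.
Qed.

Lemma topstep_iinv_loser g x : c <= lbot T g -> bot T' g x ->
  [/\ bot T w x, c < iinv T x, bot T g (iinv T x) &
      iinv T' x = iinv T (iinv T x)].
Proof.
move=> cg gx; have lg := topcase_nloser hT tc.
case/(topstep_bot hT tc): (gx) => [[_ gx']|[gc]|[gw]];
  [|by exfalso; lra|by exfalso; rewrite gw in cg; lra].
have [wx h] := loser_shift hT tc cg gx'.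
have xE : iinv T x = x - delta T w by rewrite (iinvE hT wx) /delta; ring.
split=> //; first by move: gx'; rewrite botE xE; lra.
  by rewrite xE.
rewrite -xE in gx'; rewrite (iinvE hT' gx) (iinvE hT gx') xE /= cg.
by ring.
Qed.

Lemma topstep_iinv_nloser g x : lbot T g < c -> bot T' g x ->
  [/\ bot T g x, iinv T x < c & iinv T' x = iinv T x].
Proof.
move=> gc gx.
have lw := topcase_c hT tc; have rw := topcase_w tc; have ww := width w hT.
have gx' : bot T g x.
  case/(topstep_bot hT tc): (gx) => [[]|[_ []]//|[-> ]]; first lra.
  by rewrite botE; lra.
have xE := iinvE hT gx'.
split=> //; last by rewrite (iinvE hT' gx) xE /= leNgt gc.
have gt := iinv_top hT gx'.
have [gw|gw] := pselect (g = w).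
  have : bot T' w x by rewrite -gw.
  move/(topstep_bot hT tc) => [[]|[_ []]//|[_]]; first by rewrite -gw; lra.
  by rewrite xE gw; lra.
by have := topcase_other hT tc gw; move: gt; rewrite topE; lra.
Qed.

Lemma topstep_first_return : first_return T T'.
Proof.
have lw := topcase_c hT tc; have rw := topcase_w tc.
split=> /= y yc.
- move=> /stopN_itv[//||g gy Tyc]; first lra.
  have gy' : top T' g y by apply/(topstep_top hT tc); split=> //; lra.
  have gc : lbot T g < c by have := imap_bot hT gy; rewrite botE; lra.
  by have [_ _ ?] := topstep_imap_nloser gc gy'; split=> //; exact: stopN_top gy'.
- move=> /stopN_itv[//||g gy cTy _]; first lra.
  have gy' : top T' g y by apply/(topstep_top hT tc); split=> //; lra.
  have cg : c <= lbot T g.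
    rewrite leNgt; apply/negP => /(topcase_bot hT tc).
    by have := imap_bot hT gy; rewrite botE; lra.
  have [_ _ wy ?] := topstep_imap_loser cg gy'; split=> //; first exact: stopN_top gy'.
  by have := topcase_rbot hT tc; have := imap_bot hT wy; rewrite botE; lra.
- move=> /(stopN_itv hT')[|g gy]; first by move=> /=; lra.
  have [cg|gc] := leP c (lbot T g).
    have [gy' ? wy ?] := topstep_imap_loser cg gy; split; first exact: stopN_top gy'.
    by right; split; [lra|exact: stopN_top wy].
  have [gy' ? ?] := topstep_imap_nloser gc gy.
  by split; [exact: stopN_top gy'|left].
- move=> _; have wy : top T w y by rewrite topE rw; lra.
  by have := topcase_rbot hT tc; have := imap_bot hT wy; rewrite botE; lra.
Qed.

(** The preimage of a point leaves the new domain only into the cut end of [top T w]. Unless it is a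
    bottom singularity, it is then in the bottom interval of a loser, and the next preimage is to
    the left of [c]. *)
Lemma topstep_first_return_inv : first_return (inv_iet T) (inv_iet T').
Proof.
have lw := topcase_c hT tc; have rw := topcase_w tc.
have nc : sbot T c by case: tc.
have gw g y : top T g y -> c <= y -> g = w.
  move=> gy cy; apply: contrapT => /(topcase_other hT tc).
  by move: gy; rewrite topE; lra.
split=> /= y yc.
- move=> /(stopN_itv (is_iet_inv hT))[|g gy]; first by move=> /=; lra.
  rewrite -/(iinv T y) -/(iinv T' y) => Tyc.
  have gy' : bot T' g y.
    apply/(topstep_bot hT tc).
    have gc : lbot T g < c by have gy1 : bot T g y := gy; move: gy1; rewrite botE; lra.
    have [E|ne] := pselect (g = w); last by apply: Or32.
    apply: Or33; split=> //.
    have gy1 : bot T g y := gy.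
    by move: Tyc; rewrite (iinvE hT gy1); move: gy1; rewrite E botE; lra.
  have gc : lbot T g < c by have gy1 : bot T g y := gy; move: gy1; rewrite botE; lra.
  by have [_ _ ?] := topstep_iinv_nloser gc gy'; split=> //; exact: stopN_top gy'.
- move=> /(stopN_itv (is_iet_inv hT))[|g gy]; first by move=> /=; lra.
  rewrite -/(iinv T y) -/(iinv T (iinv T y)) -/(iinv T' y) => cTy nb.
  have {}gy : bot T g y := gy.
  have gt := iinv_top hT gy.
  have gE := gw _ _ gt cTy; rewrite {}gE {g} in gy gt.
  have [|h hy] := stopN_itv (is_iet_inv hT) _ nb; first by have /= := top_itv hT gt.
  have {}hy : bot T h (iinv T y) := hy.
  have ch : c <= lbot T h.
    rewrite leNgt; apply/negP => /(topcase_bot hT tc).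
    by move: hy; rewrite botE; lra.
  have yE : iinv T y = y - delta T w by rewrite (iinvE hT gy) /delta; ring.
  have hy' : bot T' h y.
    by apply/(topstep_bot hT tc); apply: Or31; split=> //; rewrite -yE.
  have [_ _ _ ?] := topstep_iinv_loser ch hy'; split=> //; first exact: stopN_top hy'.
  have ht := iinv_top hT hy.
  have hw : h <> w by move=> E; have := topcase_nloser hT tc; rewrite -E; lra.
  by have := topcase_other hT tc hw; move: ht; rewrite topE; lra.
- move=> /(stopN_itv (is_iet_inv hT'))[|g gy]; first by move=> /=; lra.
  have {}gy : bot T' g y := gy.
  rewrite -/(iinv T y).
  have [cg|gc] := leP c (lbot T g).
    have [wy ? gy' ?] := topstep_iinv_loser cg gy; split; first exact: stopN_top wy.
    by right; split; [lra|exact: stopN_top gy'].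
  have [gy' ? ?] := topstep_iinv_nloser gc gy.
  by split; [exact: stopN_top gy'|left].
- move=> /(stopN_itv (is_iet_inv hT))[|g gy]; first by move=> /=; lra.
  have {}gy : bot T g y := gy.
  rewrite -/(iinv T y).
  have cg : c <= lbot T g.
    rewrite leNgt; apply/negP => /[dup] gc /(topcase_bot hT tc).
    by move: gy; rewrite botE; lra.
  have gt := iinv_top hT gy.
  have gw' : g <> w by move=> E; have := topcase_nloser hT tc; rewrite -E; lra.
  by have := topcase_other hT tc gw'; move: gt; rewrite topE; lra.
Qed.

End TopDynamics.

(** * Positive entries of the step matrix and visits during one return *)

Definition mstep T a b : Prop := 0 < rauzy_step_matrix T a b.

Lemma mstepE T a b : mstep T a b <->
  a = b \/ (winner T (new_len T) a /\ loser T (new_len T) b).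
Proof.
rewrite /mstep /rauzy_step_matrix /idmx.
case: eqVneq => [->|ab]; case: asboolP => h; split=> //=; try by left.
- by right.
- by case=> // E; rewrite E eqxx in ab.
Qed.

Lemma winner_inv T c g : winner (inv_iet T) c g <-> winner T c g.
Proof.
by rewrite /winner inv_ietK; split=> -[]; [right|left|right|left].
Qed.

Lemma mstep_inv T a b : mstep (inv_iet T) a b <-> mstep T a b.
Proof. by rewrite !mstepE new_len_inv winner_inv loser_inv. Qed.

Lemma mstep_top T c w a b : is_iet T -> topcase T c w -> c = new_len T ->
  mstep T a b <-> a = b \/ (a = w /\ c <= lbot T b).
Proof.
by move=> hT tc cE; rewrite mstepE -cE (winner_topcase hT tc) (loserP hT tc).
Qed.

Lemma mstep_bot T c w a b : is_iet T -> topcase (inv_iet T) c w ->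
  c = new_len T -> mstep T a b <-> a = b \/ (a = w /\ c <= ltop T b).
Proof.
move=> hT tc cE; rewrite -mstep_inv (mstep_top _ _ (is_iet_inv hT) tc) //.
by rewrite new_len_inv.
Qed.

Lemma rauzy_first_return T : is_iet T -> renormalizable T ->
  first_return T (rauzy T).
Proof.
move=> hT /(rauzyP hT)[[c [w [tc _ ->]]]|[c [w [tc _ ->]]]].
  exact: topstep_first_return.
by have := topstep_first_return_inv (is_iet_inv hT) tc; rewrite inv_ietK.
Qed.

Lemma rauzy_first_return_inv T : is_iet T -> renormalizable T ->
  first_return (inv_iet T) (inv_iet (rauzy T)).
Proof.
move=> hT rT; rewrite -rauzy_inv //; apply: rauzy_first_return.
  exact: is_iet_inv.
exact: renormalizable_inv.
Qed.

Lemma rauzy_len T : is_iet T -> renormalizable T -> 0 < len (rauzy T) < len T.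
Proof.
move=> hT /(rauzyP hT)[[c [w [tc _ ->]]]|[c [w [tc _ ->]]]] /=.
  by have := topcase_c hT tc; lra.
by have := topcase_c (is_iet_inv hT) tc; move=> /=; lra.
Qed.

(** The removed piece, without its right end, is inside the interval of the winner. *)
Lemma rauzy_cut_regular T y : is_iet T -> renormalizable T ->
  len (rauzy T) <= y < len T -> ~ stop T y \/ ~ sbot T y.
Proof.
move=> hT /(rauzyP hT)[[c [w [tc _ ->]]]|[c [w [tc _ ->]]]] /= hy.
  left; apply: (@stopN_top _ _ _ w); rewrite topE (topcase_w tc).
  by have := topcase_c hT tc; lra.
right; apply: (@sbotN_bot _ _ _ w); rewrite /bot topE (topcase_w tc).
by have := topcase_c (is_iet_inv hT) tc; move=> /=; lra.
Qed.

(** Before returning, a base point of a loser goes through the loser and then the winner if the top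
    wins, in the opposite order if the bottom wins. Any other label only goes through itself. *)
Lemma rauzy_visit T a b y : is_iet T -> renormalizable T ->
  top (rauzy T) b y ->
  (top T a y -> mstep T a b) /\
  (len (rauzy T) <= imap T y -> top T a (imap T y) -> mstep T a b).
Proof.
move=> hT /(rauzyP hT)[[c [w [tc cE ->]]]|[c [w [tc cE ->]]]] /= yb0.
  rewrite !(mstep_top _ _ hT tc cE); have [cb|bc] := leP c (lbot T b).
    have [yb _ yw _] := topstep_imap_loser hT tc cb yb0.
    by split=> [ya|_ ya]; [left; exact: top_inj ya yb|right; split=> //; exact: top_inj ya yw].
  have [yb ? _] := topstep_imap_nloser hT tc bc yb0.
  by split=> [ya|cTy]; [left; exact: top_inj ya yb|exfalso; lra].
rewrite (mstep_bot _ _ hT tc cE).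
have hI := is_iet_inv hT; have [cb|bc] := leP c (ltop T b).
  have := topstep_iinv_loser hI tc cb yb0.
  rewrite /iinv /bot inv_ietK => -[yw _ yb _].
  by split=> [ya|_ ya]; [right; split=> //; exact: top_inj ya yw|left; exact: top_inj ya yb].
have := topstep_iinv_nloser hI tc bc yb0.
rewrite /iinv /bot inv_ietK => -[yb ? _].
by split=> [ya|cTy]; [left; exact: top_inj ya yb|exfalso; lra].
Qed.

Lemma rauzy_visited T a b y : is_iet T -> renormalizable T ->
  mstep T a b -> top (rauzy T) b y ->
  top T a y \/ (~ stop T y /\ top T a (imap T y)).
Proof.
move=> hT /(rauzyP hT)[[c [w [tc cE ->]]]|[c [w [tc cE ->]]]] /= /[swap] yb0.
  rewrite (mstep_top _ _ hT tc cE); have [yb _] := (topstep_top hT tc _ _).1 yb0.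
  case=> [->|[-> cb]]; first by left.
  have [_ _ yw _] := topstep_imap_loser hT tc cb yb0.
  by right; split=> //; exact: stopN_top yb.
rewrite (mstep_bot _ _ hT tc cE).
have hI := is_iet_inv hT; have [cb|bc] := leP c (ltop T b).
  have := topstep_iinv_loser hI tc cb yb0.
  rewrite /iinv /bot inv_ietK => -[yw _ yb _].
  by case=> [->|[-> _]]; [right; split=> //; exact: stopN_top yw|left].
have := topstep_iinv_nloser hI tc bc yb0.
rewrite /iinv /bot inv_ietK => -[yb ? _].
by case=> [->|[_ cb]]; [left|exfalso; lra].
Qed.

(* The second case is that of a loser b when the bottom wins. *)
Lemma rauzy_left_end T b y : is_iet T -> renormalizable T ->
  top (rauzy T) b y ->
  (ltop (rauzy T) b = ltop T b /\ top T b y) \/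
  [/\ len (rauzy T) <= imap T y, top T b (imap T y), ~ stop T y &
      imap T y - ltop T b = y - ltop (rauzy T) b].
Proof.
move=> hT /(rauzyP hT)[[c [w [tc cE ->]]]|[c [w [tc cE ->]]]] /= yb0.
  by have [yb _] := (topstep_top hT tc _ _).1 yb0; left.
have hI := is_iet_inv hT; have [cb|bc] := leP c (ltop T b).
  have := topstep_iinv_loser hI tc cb yb0.
  rewrite /iinv /bot inv_ietK => -[yw ? yb _].
  right; split=> //; first lra; first exact: stopN_top yw.
  by rewrite (imapE hT yw) /delta /=; ring.
have := topstep_iinv_nloser hI tc bc yb0.
by rewrite /iinv /bot inv_ietK => -[yb ? _]; left.
Qed.

Definition top_length T a : R := rtop T a - ltop T a.

(** The winner is shortened by the removed piece. The losers are contained in this piece on the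
    other side, and widths agree on both sides. *)
Lemma rauzy_top_length T : is_iet T -> renormalizable T ->
  exists w, [/\ top_length (rauzy T) w = top_length T w - (len T - len (rauzy T)),
    forall g, g <> w -> top_length (rauzy T) g = top_length T g &
    forall a g, a <> g -> mstep T a g ->
      a = w /\ top_length T g <= len T - len (rauzy T)].
Proof.
move=> hT /(rauzyP hT)[[c [w [tc cE ->]]]|[c [w [tc cE ->]]]]; exists w.
  have rw := topcase_w tc; rewrite /top_length; split=> /= [|g gw|a g ag].
  - by rewrite eqxx rw; ring.
  - by case: eqVneq gw.
  - rewrite (mstep_top _ _ hT tc cE) => -[//|[-> cg]]; split=> //.
    by have := width g hT; have /= := top_len g (is_iet_inv hT); lra.
have hI := is_iet_inv hT.
have rw := topcase_w tc; rewrite /= in rw; rewrite /top_length; split=> /= [|g gw|a g ag].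
- by have := width w hT; rewrite eqxx; lra.
- by have := width g hT; case: eqVneq gw => // _ _; lra.
- rewrite (mstep_bot _ _ hT tc cE) => -[//|[-> cg]]; split=> //.
  by have := top_len g hT; lra.
Qed.

Lemma rauzy_level T a y : is_iet T -> renormalizable T -> top (rauzy T) a y ->
  exists b, forall x, top (rauzy T) a x -> top T b x.
Proof.
move=> hT /(rauzyP hT)[[c [w [tc cE ->]]]|[c [w [tc cE ->]]]] /= _.
  by exists a => x /(topstep_top hT tc)[].
have hI := is_iet_inv hT; have [ca|ac] := leP c (ltop T a).
  exists w => x ax; have := topstep_iinv_loser hI tc ca ax.
  by rewrite /bot inv_ietK; case.
exists a => x ax; have := topstep_iinv_nloser hI tc ac ax.
by rewrite /bot inv_ietK; case.
Qed.

(** Such a point is the image of a base point of a loser [g]. If the top wins, it lies in the winner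
    and is reached by the translation of [g]; if the bottom wins, it lies in [g] and is reached by
    the translation of the winner. *)
Lemma rauzy_cut_level T y : is_iet T -> renormalizable T ->
  len (rauzy T) <= y < len T -> ~ stop T y -> ~ sbot T y ->
  exists a g t, top (rauzy T) g (y - t) /\
    forall x, top (rauzy T) g x ->
      [/\ top T a (x + t), ~ stop T x & imap T x = x + t].
Proof.
move=> hT rT yc sy sby; have hI := is_iet_inv hT.
move: rT yc => /(rauzyP hT)[[c [w [tc cE ->]]]|[c [w [tc cE ->]]]] /= yc.
  have [|g gy] := stopN_itv hI _ sby.
    by have := topcase_c hT tc; move=> /=; lra.
  have {}gy : bot T g y := gy.
  have cg : c <= lbot T g.
    by rewrite leNgt; apply/negP => /(topcase_bot hT tc); move: gy; rewrite botE; lra.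
  exists w, g, (lbot T g - ltop T g).
  have gw : g <> w by move=> E; have := topcase_nloser hT tc; rewrite -E; lra.
  split.
    have gt := iinv_top hT gy; have yE := iinvE hT gy.
    apply/(topstep_top hT tc).
    have -> : y - (lbot T g - ltop T g) = iinv T y by rewrite yE; ring.
    split=> //; have := topcase_other hT tc gw; have := topcase_c hT tc.
    by move: gt; rewrite topE; lra.
  move=> x gx; have [gx' _ wx _] := topstep_imap_loser hT tc cg gx.
  by rewrite -(imapE hT gx'); split=> //; exact: stopN_top gx'.
have [|g gy] := stopN_itv hT _ sy.
  by have := topcase_c hI tc; move=> /=; lra.
have cg : c <= ltop T g.
  rewrite leNgt; apply/negP => /(topcase_bot hI tc) /=.
  by move: gy; rewrite topE; lra.
exists g, g, (lbot T w - ltop T w).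
have E x : bot (topstep (inv_iet T) c w) g x <-> top T g (x + (lbot T w - ltop T w)).
  have -> : x + (lbot T w - ltop T w) = x - delta (inv_iet T) w.
    by rewrite /delta /=; ring.
  have nl := topcase_nloser hI tc; rewrite /= in nl.
  rewrite (topstep_bot hI tc) /bot inv_ietK; split; last by move=> h; apply: Or31.
  by case=> [[]|[/= gc]|[gw]]//; exfalso; [lra|rewrite gw in cg; lra].
split; first by apply/E; rewrite subrK.
move=> x gx; have := topstep_iinv_loser hI tc cg gx.
rewrite /iinv /bot inv_ietK => -[wx _ _ _]; split; first exact/E.
  exact: stopN_top wx.
exact: imapE.
Qed.

(** Left ends of top intervals move only for losers against a bottom winner, and these start at [c]
    or beyond. *)
Lemma rauzy_ltop0 T g : is_iet T -> renormalizable T -> ltop T g = 0 ->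
  ltop (rauzy T) g = 0.
Proof.
move=> hT /(rauzyP hT)[[c [w [tc cE ->]]]|[c [w [tc cE ->]]]] //= g0.
by have := topcase_c (is_iet_inv hT) tc; case: ifP; rewrite /= ?g0; lra.
Qed.

Lemma rauzy_lbot0 T g : is_iet T -> renormalizable T -> lbot T g = 0 ->
  lbot (rauzy T) g = 0.
Proof.
move=> hT rT g0; have := @rauzy_ltop0 (inv_iet T) g (is_iet_inv hT) (renormalizable_inv rT) g0.
by rewrite rauzy_inv.
Qed.

End Dynamics.

(** * Matrices and towers *)

Section Iterates.
Variables (R : realType) (A : countType).
Implicit Types (T : iet R A) (a b g w : A) (c s x y : R) (n k : nat).

Notation inf_renorm := infinitely_renormalizable.

Lemma rauzy_iterS n T : rauzy_iter n.+1 T = rauzy_iter n (rauzy T).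
Proof. exact: iterSr. Qed.

Lemma rauzy_iterD m n T : rauzy_iter (m + n) T = rauzy_iter m (rauzy_iter n T).
Proof. exact: iterD. Qed.

Lemma inf_renorm_iter k T : inf_renorm T -> inf_renorm (rauzy_iter k T).
Proof. by move=> rT n; rewrite -rauzy_iterD. Qed.

Lemma inf_renorm0 T : inf_renorm T -> renormalizable T.
Proof. by move=> /(_ 0%N). Qed.

Lemma inf_renormS T : inf_renorm T -> inf_renorm (rauzy T).
Proof. exact: (@inf_renorm_iter 1). Qed.

Lemma is_iet_iter n T : is_iet T -> inf_renorm T -> is_iet (rauzy_iter n T).
Proof. by move=> hT rT; elim: n => //= n IH; exact: is_iet_rauzy. Qed.

Lemma rauzy_iter_inv n T : is_iet T -> inf_renorm T ->
  rauzy_iter n (inv_iet T) = inv_iet (rauzy_iter n T).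
Proof.
move=> hT rT; elim: n => //= n IH.
by rewrite /rauzy_iter /= -/(rauzy_iter n _) IH rauzy_inv //; exact: is_iet_iter.
Qed.

Lemma inf_renorm_inv T : is_iet T -> inf_renorm T -> inf_renorm (inv_iet T).
Proof.
by move=> hT rT n; rewrite rauzy_iter_inv //; exact: renormalizable_inv.
Qed.

Lemma rauzy_iter_len T n : is_iet T -> inf_renorm T ->
  0 < len (rauzy_iter n T) <= len T.
Proof.
move=> hT rT; elim: n => [|n IH]; first by case: hT; rewrite /=; lra.
by have := rauzy_len (is_iet_iter n hT rT) (rT n); move=> /=; lra.
Qed.

Lemma rauzy_iter_len_le T m n : is_iet T -> inf_renorm T -> (m <= n)%N ->
  len (rauzy_iter n T) <= len (rauzy_iter m T).
Proof.
move=> hT rT mn; rewrite -(subnK mn) rauzy_iterD.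
by have := @rauzy_iter_len (rauzy_iter m T) (n - m) (is_iet_iter _ hT rT)
  (inf_renorm_iter _ rT); lra.
Qed.

(* [reach T n a b]: the tower over the base b of the n-th induced exchange goes
   through the top interval a of T. *)
Fixpoint reach T n a b : Prop :=
  if n is n'.+1 then exists2 g, mstep T a g & reach (rauzy T) n' g b
  else a = b.

Lemma reach_inv T n a b : is_iet T -> inf_renorm T ->
  reach (inv_iet T) n a b <-> reach T n a b.
Proof.
elim: n T a => //= n IH T a hT rT.
have rT0 := inf_renorm0 rT.
have E g : reach (rauzy (inv_iet T)) n g b <-> reach (rauzy T) n g b.
  by rewrite rauzy_inv // IH //; [exact: is_iet_rauzy|exact: inf_renormS].
by split=> -[g ag gb]; exists g; move: ag; rewrite ?mstep_inv //; move=> _; exact/E.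
Qed.

Lemma finite_mstep T g : is_iet T -> renormalizable T ->
  finite_set [set a | mstep T a g].
Proof.
move=> hT rT; have [w [_ _ hw]] := rauzy_top_length hT rT.
apply: (@sub_finite_set _ _ ([set g] `|` [set w])); last first.
  by rewrite finite_setU; split; exact: finite_set1.
move=> a /= ag; have [->|nag] := pselect (a = g); first by left.
by right; case: (hw _ _ nag ag).
Qed.

Lemma finite_reach T n b : is_iet T -> inf_renorm T ->
  finite_set [set a | reach T n a b].
Proof.
elim: n T => [|n IH] T hT rT.
  by apply: sub_finite_set (finite_set1 b) => a /= ->.
have rT0 := inf_renorm0 rT.
have := @bigcup_finite _ _ [set g | reach (rauzy T) n g b]
  (fun g => [set a | mstep T a g]).
move=> /(_ (IH _ (is_iet_rauzy hT rT0) (inf_renormS rT))).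
move=> /(_ (fun g _ => finite_mstep g hT rT0)).
by apply: sub_finite_set => a /= [g ag gb]; exists g.
Qed.

Lemma step_matrix_ge0 T a b : 0 <= rauzy_step_matrix T a b.
Proof. by rewrite /rauzy_step_matrix /idmx addr_ge0 // ler0n. Qed.

(** A sum of infinite support is 0 by convention, hence the finiteness hypothesis; nonnegativity
    excludes cancellation. *)
Lemma prodmx_gt0 (M N : A -> A -> int) a b :
  (forall a b, 0 <= M a b) -> (forall a b, 0 <= N a b) ->
  finite_set [set g | 0 < N g b] ->
  0 < prodmx M N a b <-> exists2 g, 0 < M a g & 0 < N g b.
Proof.
move=> M0 N0 fN; rewrite /prodmx; split=> [/(fsumr_gt0 [::])[g _ gt0]|[g Mg Ng]].
  have Mg : M a g != 0 by apply: contraTneq gt0 => ->; rewrite mul0r ltxx.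
  have Ng : N g b != 0 by apply: contraTneq gt0 => ->; rewrite mulr0 ltxx.
  by exists g; rewrite lt_neqAle eq_sym ?Mg ?Ng ?M0 ?N0.
rewrite (@fsbigTE _ _ _ _ (fset_set [set g | 0 < N g b])); last first.
  move=> h; rewrite in_fset_set // notin_setE /= => /negP.
  by rewrite -leNgt => Nh; have /eqP -> : N h b == 0 by [rewrite eq_le Nh N0]; rewrite mulr0.
rewrite (big_rem g) /=; last by rewrite in_fset_set // inE.
by apply: ltr_wpDr; [apply: sumr_ge0 => h _; exact: mulr_ge0|exact: mulr_gt0].
Qed.

(** The factor of index [k.+1] is the step matrix of [rauzy_iter k T]; taking it off on the left
    mirrors the recursion of [reach]. *)
Lemma prod_reach T n k : is_iet T -> inf_renorm T ->
  (forall a b, 0 <= (\big[@prodmx A/@idmx A]_(k.+1 <= i < k.+1 + n)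
     rauzy_matrix T i) a b) /\
  (forall a b, 0 < (\big[@prodmx A/@idmx A]_(k.+1 <= i < k.+1 + n)
     rauzy_matrix T i) a b <-> reach (rauzy_iter k T) n a b).
Proof.
move=> hT rT; elim: n k => [|n IH] k.
  rewrite addn0 big_geq //= /idmx; split=> a b; first by rewrite ler0n.
  by case: eqVneq => [->//|/eqP].
rewrite big_ltn ?addnS ?ltnS ?leq_addr // -addSn; have [P0 PR] := IH k.+1.
have hk := is_iet_iter k hT rT.
have M0 a b : 0 <= rauzy_matrix T k.+1 a b by exact: step_matrix_ge0.
have fin b : finite_set [set g | 0 < (\big[@prodmx A/@idmx A]_(k.+2 <= i < k.+2 + n)
     rauzy_matrix T i) g b].
  apply: sub_finite_set (@finite_reach (rauzy_iter k.+1 T) n b _ _).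
  - by move=> g /=; rewrite PR.
  - exact: is_iet_iter.
  - exact: inf_renorm_iter.
split=> a b; first by apply: fsumr_ge0 => g _; exact: mulr_ge0.
rewrite prodmx_gt0 //=.
by split=> -[g ag gb]; exists g => //; exact/PR.
Qed.

(** Both end indices are included, whence [n.+1] steps; indices start at 1, whence [k.-1]. *)
Lemma rauzy_prod_reach T k n a b : is_iet T -> inf_renorm T -> (0 < k)%N ->
  0 < rauzy_prod T k (k + n) a b <-> reach (rauzy_iter k.-1 T) n.+1 a b.
Proof.
move=> hT rT; case: k => // k _; rewrite /rauzy_prod -addnS.
by have [_ ->] := @prod_reach T n.+1 k hT rT.
Qed.

End Iterates.

(** * Lengths under combinatorial minimality *)

Section Lengths.
Variables (R : realType) (A : countType).
Implicit Types (T : iet R A) (a b g w : A) (c s x y e : R) (n k : nat).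

Notation inf_renorm := infinitely_renormalizable.

Lemma top_length_gt0 T a : is_iet T -> 0 < top_length T a.
Proof. by move=> hT; rewrite /top_length; have := top_lt a hT; lra. Qed.

Lemma top_length_rauzy_le T a : is_iet T -> renormalizable T ->
  top_length (rauzy T) a <= top_length T a.
Proof.
move=> hT rT; have [w [lw lo _]] := rauzy_top_length hT rT.
have [aw|/lo ->//] := pselect (a = w).
by rewrite aw lw; have := rauzy_len hT rT; lra.
Qed.

Lemma top_length_iter_le T a m n : is_iet T -> inf_renorm T -> (m <= n)%N ->
  top_length (rauzy_iter n T) a <= top_length (rauzy_iter m T) a.
Proof.
move=> hT rT; elim: n => [|n IH]; first by rewrite leqn0 => /eqP ->.
rewrite leq_eqVlt => /predU1P[->//|]; rewrite ltnS => /IH h.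
by apply: le_trans h; apply: top_length_rauzy_le; [exact: is_iet_iter|exact: rT].
Qed.

(** When the chain from [a] to [b] first moves to some [g <> a], the label [a] wins and is shortened
    by at least the length of [g]. From then on [b] is at most as long as [g]: they are equal, or
    the induction hypothesis applies. *)
Lemma reach_top_length T n a b : is_iet T -> inf_renorm T -> a <> b ->
  reach T n a b ->
  top_length (rauzy_iter n T) b <= top_length T a - top_length (rauzy_iter n T) a.
Proof.
elim: n T a => [|n IH] T a hT rT ab //=; case=> g ag gb.
rewrite -[rauzy (rauzy_iter n T)]/(rauzy_iter n.+1 T) rauzy_iterS.
have rT0 := inf_renorm0 rT; have hT' := is_iet_rauzy hT rT0.
have rT' := inf_renormS rT.
have la := top_length_rauzy_le a hT rT0; have lg := top_length_rauzy_le g hT rT0.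
have la' := @top_length_iter_le (rauzy T) a 0 n hT' rT' isT.
have lb' := @top_length_iter_le (rauzy T) b 0 n hT' rT' isT.
have [agE|nag] := pselect (a = g).
  by rewrite -agE in gb; have := IH _ _ hT' rT' ab gb; lra.
have [w [lw lo hw]] := rauzy_top_length hT rT0.
have [aw gl] := hw _ _ nag ag.
have {}lo : top_length (rauzy T) g = top_length T g by apply: lo => gw; apply: nag; rewrite gw.
have {}la' : top_length (rauzy_iter n (rauzy T)) a <= top_length (rauzy T) a := la'.
have {}lb' : top_length (rauzy_iter n (rauzy T)) b <= top_length (rauzy T) b := lb'.
rewrite aw in la' |- *.
have [gbE|ngb] := pselect (g = b); first by rewrite gbE in lo gl; lra.
have := IH _ _ hT' rT' ngb gb.
by have := top_length_gt0 g (is_iet_iter n hT' rT'); lra.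
Qed.

(** On the losing side some interval meets the removed piece, and that of the winner does not. *)
Lemma renormalizable_labels T : is_iet T -> renormalizable T ->
  exists a b : A, a <> b.
Proof.
suff tcl T' c w : is_iet T' -> topcase T' c w -> exists a b : A, a <> b.
  by move=> hT /(topcaseP hT)[[w /tcl]|[w /tcl]]; apply=> //; exact: is_iet_inv.
move=> hT tc; have lw := topcase_c hT tc.
have [||||g [x [xc gx]]] := @top_dense _ _ (inv_iet T') c (len T') => //=; try lra.
  exact: is_iet_inv.
exists g, w => gw; have := topcase_rbot hT tc.
by move: gx; rewrite topE gw /=; lra.
Qed.

(** A singularity that is neither [len T] nor an accumulation point is isolated, hence the left end
    of a top interval. *)
Lemma stop_countable T : is_iet T -> countable (stop T).
Proof.
move=> hT.
have fl : countable (limit_point (stop T)).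
  by apply: finite_set_countable; case: hT => _ [].
have cU : countable (\bigcup_(i in [set: option bool]) match i with
    | None => [set len T] | Some true => range (ltop T)
    | Some false => limit_point (stop T) end).
  apply: bigcup_countable => // -[[]|] _ //.
  - by apply: sub_countable (card_image_le _ _) _; exact: countableP.
apply: sub_countable cU; apply: subset_card_le => y sy.
have [yl|ny] := pselect (limit_point (stop T) y); first by exists (Some false).
have [yE|yl] := eqVneq y (len T); first by exists None.
exists (Some true) => //.
have hy := stop_itv sy; have {}yl : y < len T by rewrite lt_neqAle yl; lra.
have [e e0 He] := not_limit_pt ny.
have [|a <-] := stop_isolated_right hT sy yl e0; last by exists a.
move=> z sz yz; rewrite leNgt; apply/negP => ze.
by have := He _ sz; rewrite ger0_norm; lra.
Qed.

(** The top intervals cover the domain up to the null set [stop T], so by countable subadditivity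
    their lengths add up to at least [len T]. *)
Lemma lengths_exhaust T e : is_iet T -> 0 < e ->
  exists s : seq A, uniq s /\ len T < \sum_(a <- s) top_length T a + e.
Proof.
move=> hT e0.
(* Labels are enumerated through their codes; an integer coding no label gets the empty set. *)
pose F (n : nat) : set R := if @pickle_inv A n is Some a then top T a else set0.
pose s N := pmap (@pickle_inv A) (iota 0 N).
have us N : uniq (s N).
  rewrite /s; apply: (@pmap_uniq _ _ _ (@pickle A)); last exact: iota_uniq.
  exact: pickle_invK.
have mF n : measurable (F n).
  by rewrite /F; case: (pickle_inv n) => [a|] //; exact: measurable_itv.
have sumE N : (\sum_(0 <= i < N) lebesgue_measure (F i) =
    (\sum_(a <- s N) top_length T a)%:E)%E.
  elim: N => [|N IH]; first by rewrite big_geq // /s big_nil.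
  rewrite big_nat_recr //= IH /s -addn1 iotaD pmap_cat big_cat /= add0n /F EFinD.
  congr (_ + _)%E; case: (pickle_inv N) => [a|] /=; last by rewrite big_nil measure0.
  rewrite big_cons big_nil addr0 /top lebesgue_measure_itv /= lte_fin top_lt //.
apply: contrapT => nex.
have bnd N : (\sum_(0 <= i < N) lebesgue_measure (F i) <= (len T - e)%:E)%E.
  rewrite sumE lee_fin leNgt; apply/negP => h; apply: nex; exists (s N).
  by split => //; lra.
have l0 : 0 < len T by case: hT.
have ms : measurable (stop T).
  exact: countable_measurable (stop_countable hT).
(* Index 0 is given to the singularities, which moves the labels up by one. *)
pose G n := if n is n'.+1 then F n' else stop T.
have mG n : measurable (G n) by case: n.
have : (lebesgue_measure (dom T) <= \sum_(0 <= n <oo) lebesgue_measure (G n))%E.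
  apply: measure_sigma_subadditive => //.
  - exact: measurable_itv.
  - move=> x xd; have [sx|nx] := pselect (stop T x); first by exists 0%N.
    have [|a ax] := stopN _ nx; first by rewrite -domE.
    by exists (pickle a).+1 => //=; rewrite /F pickleK_inv.
apply/negP; rewrite -ltNge /dom lebesgue_measure_itv /= lte_fin l0 sube0.
apply: (@le_lt_trans _ _ (len T - e)%:E); last by rewrite lte_fin; lra.
apply: lime_le.
  by apply: is_cvg_nneseries.
apply: nearW => -[|n]; first by have := bnd 0%N; rewrite !big_geq.
rewrite big_nat_recl //= countable_lebesgue_measure0 ?add0e //.
exact: stop_countable.
Qed.

(** Domain and winner shrink by the same amount, so the difference is constant if the winner is in
    [s] and decreases otherwise. *)
Lemma deficit_le T (s : seq A) n : is_iet T -> inf_renorm T -> uniq s ->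
  len (rauzy_iter n T) - \sum_(a <- s) top_length (rauzy_iter n T) a <=
  len T - \sum_(a <- s) top_length T a.
Proof.
move=> hT rT us; elim: n => // n IH; apply: le_trans IH.
set S := rauzy_iter n T.
have hS : is_iet S by exact: is_iet_iter.
have rS : renormalizable S by exact: rT.
rewrite -[rauzy_iter n.+1 T]/(rauzy S).
have [w [lw lo _]] := rauzy_top_length hS rS.
have [ws|ws] := boolP (w \in s).
  rewrite !(big_rem _ ws) /= lw.
  have -> : \sum_(a <- rem w s) top_length (rauzy S) a = \sum_(a <- rem w s) top_length S a.
    apply: eq_big_seq => a; rewrite mem_rem_uniq // inE => /andP[/eqP aw _].
    exact: lo.
  by rewrite -[new_len S]/(len (rauzy S)); lra.
have -> : \sum_(a <- s) top_length (rauzy S) a = \sum_(a <- s) top_length S a.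
  apply: eq_big_seq => a sa; apply: lo => aw; by rewrite -aw sa in ws.
by have := rauzy_len hS rS; lra.
Qed.

(** Combinatorial minimality with steps counted from 0 and [n = 0] allowed. *)
Definition all_reach T : Prop :=
  forall k a b, exists n, reach (rauzy_iter k T) n a b.

Lemma top_length_to0 T b e : is_iet T -> inf_renorm T -> all_reach T -> 0 < e ->
  exists n, top_length (rauzy_iter n T) b < e.
Proof.
move=> hT rT cm e0; apply: contrapT => nex.
have lb n : e <= top_length (rauzy_iter n T) b.
  by rewrite leNgt; apply/negP => h; apply: nex; exists n.
have [a ab] : exists a, a <> b.
  have [a1 [a2 a12]] := renormalizable_labels hT (inf_renorm0 rT).
  have [E|] := pselect (a1 = b); last by exists a1.
  by exists a2 => E2; apply: a12; rewrite E E2.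
have step m : exists n, top_length (rauzy_iter n T) a <= top_length T a - m%:R * e.
  elim: m => [|m [n Hn]]; first by exists 0%N; rewrite mul0r subr0.
  have [n' rn] := cm n a b.
  have := reach_top_length (is_iet_iter n hT rT) (inf_renorm_iter n rT) ab rn.
  rewrite -rauzy_iterD => h; exists (n' + n)%N.
  by have := lb (n' + n)%N; rewrite -natr1 mulrDl mul1r; lra.
(* Enough passages through [a] to use up its initial length. *)
have [n] := step (Num.bound (top_length T a / e)).
have := top_length_gt0 a (is_iet_iter n hT rT).
have /archi_boundP : 0 <= top_length T a / e.
  by apply: divr_ge0; have := top_length_gt0 a hT; lra.
by rewrite ltr_pdivrMr //; lra.
Qed.

Lemma sum_top_length_to0 T (s : seq A) e : is_iet T -> inf_renorm T ->
  all_reach T -> 0 < e ->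
  exists n, \sum_(a <- s) top_length (rauzy_iter n T) a < e.
Proof.
move=> hT rT cm; elim: s e => [|a s IH] e e0.
  by exists 0%N; rewrite big_nil.
have [|n1 h1] := IH (e / 2); first lra.
have [|n2 h2] := @top_length_to0 T a (e / 2) hT rT cm; first lra.
exists (maxn n1 n2); rewrite big_cons.
have h3 := top_length_iter_le a hT rT (leq_maxr n1 n2).
have h4 : \sum_(a <- s) top_length (rauzy_iter (maxn n1 n2) T) a <=
    \sum_(a <- s) top_length (rauzy_iter n1 T) a.
  by apply: ler_sum => b _; exact: top_length_iter_le (leq_maxl _ _).
by lra.
Qed.

Lemma all_reach_len T e : is_iet T -> inf_renorm T -> all_reach T -> 0 < e ->
  exists n, len (rauzy_iter n T) < e.
Proof.
move=> hT rT cm e0; have [|s [us hs]] := @lengths_exhaust T (e / 2) hT; first lra.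
have [|n hn] := @sum_top_length_to0 T s (e / 2) hT rT cm; first lra.
by exists n; have := deficit_le n hT rT us; lra.
Qed.

End Lengths.

(** * Orbits and invariant sets *)

Section Orbits.
Variables (R : realType) (A : countType).
Implicit Types (T : iet R A) (a b g w : A) (c s x y e : R) (n k : nat).

Definition fwd_inf T x : Prop := forall n, ~ stop T (iter n (imap T) x).

Lemma imap_itv T y : is_iet T -> 0 < y < len T -> ~ stop T y ->
  0 < imap T y < len T.
Proof. by move=> hT yl /(stopN_itv hT yl)[a /(imap_bot hT)/(bot_itv hT)]. Qed.

Lemma imapNK T y : is_iet T -> 0 < y < len T -> ~ stop T y ->
  iinv T (imap T y) = y.
Proof. by move=> hT yl /(stopN_itv hT yl)[a]; exact: imapK. Qed.

Lemma fwd_inf_itv T x n : is_iet T -> 0 < x < len T -> fwd_inf T x ->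
  0 < iter n (imap T) x < len T.
Proof. by move=> hT xl fx; elim: n => //= n IH; apply: imap_itv. Qed.

Lemma fwd_infS T x : is_iet T -> ~ stop T x -> fwd_inf T (imap T x) -> fwd_inf T x.
Proof. by move=> hT sx fx [//|n]; rewrite iterSr. Qed.

Lemma fwd_inf_imap T x : fwd_inf T x -> fwd_inf T (imap T x).
Proof. by move=> fx n; rewrite -iterSr. Qed.

Section Induced.
Variables T T' : iet R A.
Hypotheses (hT : is_iet T) (hT' : is_iet T') (fr : first_return T T').
Hypothesis lT' : len T' < len T.

(** Either the two orbits are at the same point, or that of [T] is halfway through a return of time
    2. The second clause transfers bounds along the orbit of [T] to that of [T']. *)
Lemma track x n : 0 < x < len T' -> fwd_inf T' x ->
  exists j, (iter n (imap T) x = iter j (imap T') x \/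
    (iter n (imap T) x = imap T (iter j (imap T') x) /\
     len T' <= iter n (imap T) x)) /\
  forall i', (0 < i' <= j)%N ->
    exists2 i, (0 < i <= n)%N & iter i' (imap T') x = iter i (imap T) x.
Proof.
move=> xl fx; have [fA fB fC _] := fr.
elim: n => [|n [j [IH Hi]]]; first by exists 0%N; split; [left|case].
have yl := fwd_inf_itv j hT' xl fx; have sy := fx j.
have old i' : (0 < i' <= j)%N ->
    exists2 i, (0 < i <= n.+1)%N & iter i' (imap T') x = iter i (imap T) x.
  by move=> /Hi[i hi E]; exists i => //; lia.
have [sy' Ty] := fC _ yl sy.
case: IH => [E|[E cE]].
  case: Ty => [Tyc|[cTy _]]; last by exists j; split=> //; right; rewrite /= E.
  have [_ T'y] := fA _ yl sy' Tyc.
  exists j.+1; split; first by left; rewrite /= E T'y.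
  move=> i' hi'; have [E'|ne] := eqVneq i' j.+1; last by apply: old; lia.
  by exists n.+1; [lia|rewrite E' /= T'y E].
rewrite E in cE; case: Ty => [|[cTy sTy]]; first by rewrite ltNge cE.
have [_ T'y _] := fB _ yl sy' cTy sTy.
exists j.+1; split; first by left; rewrite /= E T'y.
move=> i' hi'; have [E'|ne] := eqVneq i' j.+1; last by apply: old; lia.
by exists n.+1; [lia|rewrite E' /= T'y E].
Qed.

Lemma untrack x j : 0 < x < len T' -> fwd_inf T' x ->
  exists n, iter j (imap T') x = iter n (imap T) x /\
  forall i, (0 < i <= n)%N ->
    len T' <= iter i (imap T) x \/
    exists2 i', (0 < i' <= j)%N & iter i (imap T) x = iter i' (imap T') x.
Proof.
move=> xl fx; have [fA fB fC _] := fr.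
elim: j => [|j [n [E Hi]]]; first by exists 0%N; split=> //; case.
have yl := fwd_inf_itv j hT' xl fx; have sy := fx j.
have old i : (0 < i <= n)%N -> len T' <= iter i (imap T) x \/
    exists2 i', (0 < i' <= j.+1)%N & iter i (imap T) x = iter i' (imap T') x.
  by move=> /Hi[?|[i' hi' E']]; [left|right; exists i' => //; lia].
have [sy' Ty] := fC _ yl sy.
case: Ty => [Tyc|[cTy sTy]].
  have [_ T'y] := fA _ yl sy' Tyc.
  exists n.+1; split; first by rewrite /= T'y E.
  move=> i hi; have [E'|ne] := eqVneq i n.+1; last by apply: old; lia.
  by right; exists j.+1; [lia|rewrite E' /= T'y E].
have [_ T'y _] := fB _ yl sy' cTy sTy.
exists n.+2; split; first by rewrite /= T'y E.
move=> i hi; have [E'|ne] := eqVneq i n.+2.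
  by right; exists j.+1; [lia|rewrite E' /= T'y E].
have [E'|ne'] := eqVneq i n.+1; last by apply: old; lia.
by left; rewrite E' /= -E.
Qed.

Lemma fwd_inf_induced x : 0 < x < len T' -> fwd_inf T x -> fwd_inf T' x.
Proof.
move=> xl fx; have [fA fB _ _] := fr.
have step y : 0 < y < len T' -> fwd_inf T y ->
    [/\ ~ stop T' y, 0 < imap T' y < len T' & fwd_inf T (imap T' y)].
  move=> yl fy; have sy := fy 0%N; have [Tyc|cTy] := ltP (imap T y) (len T').
    have [s' ->] := fA _ yl sy Tyc; split=> //; last exact: fwd_inf_imap.
    have h0 : 0 < y < len T by have := lT'; lra.
    by have := imap_itv hT h0 sy; lra.
  have [s' -> Tc] := fB _ yl sy cTy (fy 1%N).
  split=> //; last by do 2 apply: fwd_inf_imap.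
  have h1 : 0 < imap T y < len T by apply: imap_itv => //; have := lT'; lra.
  by have := imap_itv hT h1 (fy 1%N); lra.
have all n : 0 < iter n (imap T') x < len T' /\ fwd_inf T (iter n (imap T') x).
  by elim: n => //= n [h1 h2]; have [] := step _ h1 h2.
by move=> n; have [h1 h2] := all n; have [] := step _ h1 h2.
Qed.

Lemma fwd_inf_of_induced x : 0 < x < len T' -> fwd_inf T' x -> fwd_inf T x.
Proof.
move=> xl fx n; have [_ _ fC _] := fr.
have [j [Ej _]] := track n xl fx.
have [sy Ty] := fC _ (fwd_inf_itv j hT' xl fx) (fx j).
case: Ej => [->//|[E cE]]; rewrite E in cE *.
by case: Ty => [|[]//]; rewrite ltNge cE.
Qed.

End Induced.

Definition regular T x : Prop :=
  [/\ 0 < x < len T, fwd_inf T x & fwd_inf (inv_iet T) x].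

Lemma regular_rauzy T x : is_iet T -> renormalizable T -> regular T x ->
  x < len (rauzy T) -> regular (rauzy T) x.
Proof.
move=> hT rT [xl fx bx] xc; have hT' := is_iet_rauzy hT rT.
have lT := rauzy_len hT rT; have xl' : 0 < x < len (rauzy T) by lra.
split=> //.
  by apply: (@fwd_inf_induced T) => //; [exact: rauzy_first_return|lra].
apply: (@fwd_inf_induced (inv_iet T)) => //.
- exact: is_iet_inv.
- exact: rauzy_first_return_inv.
- by move: lT => /andP[].
Qed.

(** Such points come from the countably many singularities by finitely many inverse steps. *)
Lemma fwd_hit_countable T : is_iet T ->
  countable [set x | 0 < x < len T /\ ~ fwd_inf T x].
Proof.
move=> hT.
have hit n x : 0 < x < len T -> stop T (iter n (imap T) x) ->
    exists m s, stop T s /\ x = iter m (iinv T) s.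
  elim: n x => [|n IH] x xl; first by exists 0%N, x.
  rewrite iterSr => sx; have [s0|s0] := pselect (stop T x); first by exists 0%N, x.
  have [m [s [ss E]]] := IH _ (imap_itv hT xl s0) sx.
  by exists m.+1, s; split=> //=; rewrite -E imapNK.
have : countable (\bigcup_(m in [set: nat]) [set iter m (iinv T) s | s in stop T]).
  apply: bigcup_countable => // m _.
  by apply: sub_countable (card_image_le _ _) _; exact: stop_countable.
apply: sub_countable; apply: subset_card_le => x [xl /existsNP[n /contrapT sx]].
by have [m [s [ss ->]]] := hit n x xl sx; exists m => //; exists s.
Qed.

Lemma regular_dense T p q : is_iet T -> 0 <= p -> p < q -> q <= len T ->
  exists2 x, p < x < q & regular T x.
Proof.
move=> hT p0 pq ql; have cF := fwd_hit_countable hT.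
have cB := fwd_hit_countable (is_iet_inv hT).
have [x xpq nx] : exists2 x, p < x < q &
    ~ (\bigcup_(d in [set: bool])
       [set x | 0 < x < len T /\ ~ fwd_inf (if d then T else inv_iet T) x]) x.
  by apply: countable_avoid pq; apply: bigcup_countable => // -[] _.
have xl : 0 < x < len T by lra.
exists x => //; split=> //; apply: contrapT => nf; apply: nx.
  by exists true.
by exists false.
Qed.

(** * Invariant sets *)

Definition closed_fwd T (F : set R) : Prop :=
  forall y, F y -> 0 < y < len T -> ~ stop T y -> F (imap T y).

Definition invariant T F : Prop := closed_fwd T F /\ closed_fwd (inv_iet T) F.

Lemma closed_fwd_induced T T' F : is_iet T -> first_return T T' ->
  len T' < len T -> closed_fwd T F -> closed_fwd T' F.
Proof.
move=> hT [fA fB fC _] lT' cF y Fy yl sy.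
have yl' : 0 < y < len T by lra.
have [sy' [Tyc|[cTy sTy]]] := fC _ yl sy.
  by have [_ ->] := fA _ yl sy' Tyc; exact: cF.
have [_ -> _] := fB _ yl sy' cTy sTy.
by apply: (cF) => //; [exact: cF|exact: imap_itv].
Qed.

Lemma invariant_rauzy T F : is_iet T -> renormalizable T -> invariant T F ->
  invariant (rauzy T) F.
Proof.
move=> hT rT [cF cB]; have lT := rauzy_len hT rT; split.
  by apply: closed_fwd_induced (rauzy_first_return hT rT) _ cF => //; lra.
apply: closed_fwd_induced (rauzy_first_return_inv hT rT) _ cB.
  exact: is_iet_inv.
by move: lT => /andP[].
Qed.

(** A point of the removed piece is not singular on both sides, so the map or its inverse applies to
    it and brings it back in one step. *)
Lemma invariant_meets T F : is_iet T -> renormalizable T -> invariant T F ->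
  (exists2 y, F y & 0 < y < len T) ->
  exists2 y, F y & 0 < y < len (rauzy T).
Proof.
move=> hT rT [cF cB] [y Fy yl].
have [yc|cy] := ltP y (len (rauzy T)); first by exists y => //; lra.
have [_ _ _ gF] := rauzy_first_return hT rT.
have [_ _ _ gB] := rauzy_first_return_inv hT rT.
have hy : len (rauzy T) <= y < len T by lra.
have [sy|sy] := rauzy_cut_regular hT rT hy.
  exists (imap T y); first exact: cF.
  by have := imap_itv hT yl sy; have := gF _ hy sy; lra.
exists (iinv T y); first exact: cB.
have := @imap_itv (inv_iet T) y (is_iet_inv hT) yl sy.
by have := gB _ hy sy; rewrite /iinv /=; lra.
Qed.

Notation inf_renorm := infinitely_renormalizable.

Lemma invariant_iter T F n : is_iet T -> inf_renorm T -> invariant T F ->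
  (exists2 y, F y & 0 < y < len T) ->
  invariant (rauzy_iter n T) F /\ exists2 y, F y & 0 < y < len (rauzy_iter n T).
Proof.
move=> hT rT iF mF; elim: n => //= n [IH1 IH2].
have hS := is_iet_iter n hT rT; have rS := rT n.
by split; [exact: invariant_rauzy|exact: invariant_meets].
Qed.

Lemma invariant_reach T F n a b : is_iet T -> inf_renorm T -> invariant T F ->
  reach T n a b -> (exists2 y, F y & top (rauzy_iter n T) b y) ->
  exists2 y, F y & top T a y.
Proof.
elim: n T a => [|n IH] T a hT rT iF; first by move=> /= ->.
rewrite rauzy_iterS => -[g ag gb] /= mF.
have rT0 := inf_renorm0 rT; have hT' := is_iet_rauzy hT rT0.
have [y Fy gy] := IH _ _ hT' (inf_renormS rT) (invariant_rauzy hT rT0 iF) gb mF.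
have [ay|[sy ay]] := rauzy_visited hT rT0 ag gy; first by exists y.
exists (imap T y) => //; apply: iF.1 => //.
by have := top_itv hT' gy; have := rauzy_len hT rT0; lra.
Qed.

(** By condition (ii), on one of the two sides singularities do not accumulate at 0. *)
Lemma leftmost_exists T : is_iet T -> renormalizable T ->
  exists g, ltop T g = 0 \/ lbot T g = 0.
Proof.
move=> hT [_ nacc _].
have am T1 : is_iet T1 -> limit_point (stop T1) 0 -> acc_min T1 0.
  by move=> h1 l0; split=> // s /(limit_stop h1)/stop_itv; lra.
have [l0|/(leftmostP hT)[g g0]] := pselect (limit_point (stop T) 0); last first.
  by exists g; left.
have hI := is_iet_inv hT.
have [l0'|/(leftmostP hI)[g g0]] := pselect (limit_point (stop (inv_iet T)) 0).
  by case: nacc; split; exact: am.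
by exists g; right.
Qed.

Lemma invariant_all_tops T F k a : is_iet T -> inf_renorm T -> all_reach T ->
  invariant T F -> (exists2 y, F y & 0 < y < len T) ->
  exists2 y, F y & top (rauzy_iter k T) a y.
Proof.
move=> hT rT cm iF mF; have [g g0] := leftmost_exists hT (inf_renorm0 rT).
have g0n n : ltop (rauzy_iter n T) g = 0 \/ lbot (rauzy_iter n T) g = 0.
  elim: n => //= n; have hS := is_iet_iter n hT rT.
  by case=> h; [left; apply: rauzy_ltop0|right; apply: rauzy_lbot0].
have meet m : exists2 y, F y & top (rauzy_iter m T) g y.
  have hS := is_iet_iter m hT rT.
  (* Once the domain is shorter than the interval [g] of step [m], its interior points all lie in
     that interval, which is adjacent to 0. *)
  have [m' hm'] := all_reach_len hT rT cm (top_length_gt0 g hS).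
  have [_ [y Fy yl]] := invariant_iter (maxn m m') hT rT iF mF.
  have h1 := rauzy_iter_len_le hT rT (leq_maxr m m').
  have yg : 0 < y < top_length (rauzy_iter m T) g by lra.
  rewrite /top_length in yg; have wg := width g hS.
  have [h|h] := g0n m; first by exists y => //; rewrite topE; lra.
  have yb0 : bot (rauzy_iter m T) g y by rewrite botE; lra.
  exists (iinv (rauzy_iter m T) y); last exact: iinv_top.
  have [[_ cB] _] := invariant_iter m hT rT iF mF.
  by apply: cB => //; [exact: bot_itv yb0|exact: sbotN_bot yb0].
have [n rn] := cm k a g.
apply: (invariant_reach (is_iet_iter k hT rT) (inf_renorm_iter k rT) _ rn).
  by have [] := invariant_iter k hT rT iF mF.
by rewrite -rauzy_iterD.
Qed.

(** Levels of towers cover the regular points: a point of the removed piece is first pulled back to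
    the base of a loser by [rauzy_cut_level], and the translations add up. *)
Lemma level T n z : is_iet T -> inf_renorm T -> regular T z ->
  exists a b t, [/\ top T a z, top (rauzy_iter n T) b (z - t) &
    forall y, top (rauzy_iter n T) b y -> top T a (y + t) /\
      forall F, invariant T F -> F y -> F (y + t)].
Proof.
elim: n T z => [|n IH] T z hT rT rz; have [zl fz bz] := rz.
  have [a az] := stopN_itv hT zl (fz 0%N).
  by exists a, a, 0; rewrite subr0; split=> // y ay; rewrite addr0.
rewrite rauzy_iterS; have rT0 := inf_renorm0 rT; have hT' := is_iet_rauzy hT rT0.
have rT' := inf_renormS rT; have lT := rauzy_len hT rT0.
have [zc|cz] := ltP z (len (rauzy T)).
  have [a' [b [t [az bt Hb]]]] := IH _ _ hT' rT' (regular_rauzy hT rT0 rz zc).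
  have [a sub] := rauzy_level hT rT0 az.
  exists a, b, t; split=> //; first exact: sub.
  move=> y /Hb[ay HF]; split; first exact: sub.
  by move=> F iF; apply: HF; exact: invariant_rauzy.
have [|a [g [t0 [gz Hg]]]] := @rauzy_cut_level _ _ T z hT rT0 _ (fz 0%N) (bz 0%N).
  by lra.
have [az' sz' Tz'] := Hg _ gz; rewrite subrK in az' Tz'.
have zl' := top_itv hT' gz; have zl'' : 0 < z - t0 < len T by lra.
have rz' : regular T (z - t0).
  split=> //; first by apply: fwd_infS => //; rewrite Tz'.
  have Tz : iinv T z = z - t0 by rewrite -[in LHS]Tz' imapNK.
  by move=> m; have := bz m.+1; rewrite iterSr -/(iinv T z) Tz.
have [|a' [b [t1 [az bt Hb]]]] := IH _ (z - t0) hT' rT'.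
  by apply: regular_rauzy => //; lra.
have E := top_inj hT' gz az; rewrite -{a'}E in az Hb.
exists a, b, (t1 + t0); split=> //.
  by rewrite (_ : z - (t1 + t0) = z - t0 - t1) //; ring.
move=> y /Hb[gy HF]; have [ay sy Ty] := Hg _ gy; rewrite addrA; split=> // F iF Fy.
rewrite -Ty; apply: iF.1 => //.
  by apply: HF => //; exact: invariant_rauzy.
by have := top_itv hT' gy; lra.
Qed.

Lemma invariant_dense T F : is_iet T -> inf_renorm T -> all_reach T ->
  invariant T F -> (exists2 y, F y & 0 < y < len T) ->
  dom T `<=` closure F.
Proof.
move=> hT rT cm iF mF x; rewrite domE => xl U /nbhs_ballP[e e0 sU].
have l0 : 0 < len T by case: hT.
have [z zx rz] : exists2 z, x - e / 2 < z < x + e / 2 & regular T z.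
  have [|||z zx rz] := @regular_dense T (Num.max 0 (x - e / 2))
    (Num.min (len T) (x + e / 2)) hT.
  - by rewrite le_max lexx.
  - by rewrite gt_max !lt_min; rewrite /= in e0; apply/andP; split; apply/andP; split; lra.
  - by rewrite ge_min lexx.
  move: zx; rewrite gt_max lt_min => /andP[/andP[_ h1] /andP[_ h2]].
  by exists z => //; rewrite h1.
have [|n ln] := @all_reach_len _ _ T (e / 2) hT rT cm.
  by rewrite /= in e0; lra.
have [a [b [t [az bt Hb]]]] := level n hT rT rz.
have [y Fy yb0] := invariant_all_tops n b hT rT cm iF mF.
have [_ HF] := Hb _ yb0.
exists (y + t); split; first exact: HF.
have hS := is_iet_iter n hT rT.
(* Both [y + t] and [z] are on one level, shorter than [e / 2], and [z] is within [e / 2] of [x]. *)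
have := top_itv hS yb0; have := top_itv hS bt.
by move=> ? ?; apply: sU; rewrite /ball /= ltr_norml; lra.
Qed.

Lemma iter_imap_itv T x n : is_iet T -> 0 < x < len T ->
  (forall m, (m < n)%N -> ~ stop T (iter m (imap T) x)) ->
  0 < iter n (imap T) x < len T.
Proof.
move=> hT xl; elim: n => //= n IH h; apply: imap_itv => //; last exact: h.
by apply: IH => m mn; apply: h; lia.
Qed.

Lemma invariant_orbit T x : is_iet T -> 0 < x < len T -> invariant T (orbit T x).
Proof.
have half T1 : is_iet T1 -> 0 < x < len T1 -> closed_fwd T1 (orbit T1 x).
  move=> hT xl y [[N hN <-]|[N hN yE]] yl sy.
    left; exists N.+1 => // n; rewrite ltnS leq_eqVlt => /predU1P[->//|].
    exact: hN.
  (* A backward point is sent to the previous one, or to the first forward one if it is [x]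
     itself. *)
  case: N hN yE => [|N] hN yE.
    rewrite /= in yE; rewrite -yE; left; exists 1%N => // -[|//] _ /=.
    by rewrite yE.
  right; exists N; first by move=> n nN; apply: hN; lia.
  have hI := is_iet_inv hT.
  have h1 : 0 < iter N (imap (inv_iet T1)) x < len (inv_iet T1).
    by apply: iter_imap_itv => // m mN; apply: hN; lia.
  by have := imapNK hI h1 (hN N (ltnSn _)); rewrite /iinv inv_ietK -yE /= => ->.
move=> hT xl; split; first exact: half.
have := half _ (is_iet_inv hT) xl.
by rewrite /orbit /backward_orbit inv_ietK setUC.
Qed.

Lemma all_reach_minimal T : is_iet T -> inf_renorm T -> all_reach T ->
  no_connection T /\ minimal T.
Proof.
move=> hT rT cm.
have dense x : 0 < x < len T -> dom T `<=` closure (orbit T x).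
  move=> xl; apply: invariant_dense => //; first exact: invariant_orbit.
  by exists x => //; left; exists 0%N.
split=> [x [xl ff fb]|x].
  (* A finite orbit is closed; being dense, it would be the whole domain, which is uncountable. *)
  have fo : finite_set (orbit T x) by rewrite /orbit finite_setU.
  have co : closed (orbit T x).
    by apply: compact_closed; [exact: norm_hausdorff|exact: finite_compact].
  have [||y yl ny] := @countable_avoid R (orbit T x) 0 (len T).
  - exact: finite_set_countable.
  - by lra.
  have := dense x xl y; rewrite -((closure_id _).1 co) domE => h.
  by apply: ny; apply: h; lra.
(* A point singular on both sides, such as 0 or [len T], is its whole orbit. *)
rewrite domE => xl io; have [x0|x0] := pselect (stop T x /\ sbot T x).
  case: io; apply: sub_finite_set (finite_set1 x) => y [[[|N] hN]|[[|N] hN]].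
  - by move=> <-.
  - by case: (hN 0%N isT); case: x0.
  - by move=> <-.
  - by case: (hN 0%N isT); case: x0.
apply: dense.
have x00 : x != 0.
  by apply: contra_notN x0 => /eqP ->; split; [exact: stop0|exact: (stop0 (is_iet_inv hT))].
have xll : x != len T.
  by apply: contra_notN x0 => /eqP ->; split; [exact: stopl|exact: (stopl (is_iet_inv hT))].
by rewrite !lt_neqAle eq_sym x00 xll.
Qed.

End Orbits.

(** * Density of half-orbits *)

Section Good.
Variables (R : realType) (A : countType).
Implicit Types (T : iet R A) (a b g w : A) (c s x y e p q : R) (n k : nat).

Definition hits_all T x : Prop := forall p q, 0 <= p -> p < q -> q <= len T ->
  exists n, p < iter n (imap T) x < q.

(** The form of minimality without connections that is symmetric in time and passes to induced
    exchanges. *)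
Definition good T : Prop :=
  [/\ forall x, 0 < x < len T -> fwd_inf T x -> hits_all T x,
      forall x, 0 < x < len T -> fwd_inf (inv_iet T) x -> hits_all (inv_iet T) x &
      forall x, 0 < x < len T -> fwd_inf T x \/ fwd_inf (inv_iet T) x].

Lemma good_inv T : good T -> good (inv_iet T).
Proof.
by case=> h1 h2 h3; split; rewrite ?inv_ietK // => x /h3[]; [right|left].
Qed.

Lemma connection_inv T x : connection (inv_iet T) x -> connection T x.
Proof. by case=> h1 h2 h3; rewrite /backward_orbit inv_ietK in h3; split. Qed.

Lemma orbit_inv T x : orbit (inv_iet T) x = orbit T x.
Proof. by rewrite /orbit /backward_orbit inv_ietK setUC. Qed.

Lemma minimal_inv T : minimal T -> minimal (inv_iet T).
Proof. by move=> h x; rewrite orbit_inv; exact: h. Qed.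

Lemma fwd_finite T x : ~ fwd_inf T x -> finite_set (forward_orbit T x).
Proof.
move=> /existsNP[N /contrapT sN].
apply: sub_finite_set (finite_image (fun n => iter n (imap T) x) (finite_II N.+1)).
move=> y [M hM <-]; exists M => //=; rewrite ltnS leqNgt; apply/negP => NM.
exact: (hM N NM).
Qed.

(** Fixed points have finite half-orbits, so [connection] counts them. *)
Lemma fixed_connection T g : is_iet T -> ltop T g = lbot T g ->
  exists x, connection T x.
Proof.
move=> hT e; have lg := top_lt g hT.
pose x := (ltop T g + rtop T g) / 2.
have gx : top T g x by rewrite topE /x; lra.
have fx T1 : imap T1 x = x -> finite_set (forward_orbit T1 x).
  move=> E; apply: sub_finite_set (finite_set1 x) => y [n _ <-] /=.
  by elim: n => //= n ->.
exists x; split; first exact: top_itv gx.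
  by apply: fx; rewrite (imapE hT gx) e; ring.
have gx' : bot T g x by move: gx; rewrite topE botE (width g hT) e; lra.
by apply: fx; rewrite -/(iinv T x) (iinvE hT gx') e; ring.
Qed.

Lemma good_no_fixed T g : is_iet T -> good T -> ltop T g <> lbot T g.
Proof.
move=> hT [h _ _] e; have lg := top_lt g hT.
pose x := (ltop T g + rtop T g) / 2.
have gx : top T g x by rewrite topE /x; lra.
have xl := top_itv hT gx.
have E n : iter n (imap T) x = x.
  by elim: n => //= n ->; rewrite (imapE hT gx) e; ring.
have fx : fwd_inf T x by move=> n; rewrite E; exact: stopN_top gx.
have [|||n] := h x xl fx 0 x => //; try lra.
by rewrite E; lra.
Qed.

Lemma rightmost_exists T : is_iet T -> renormalizable T ->
  exists g, rtop T g = len T \/ rbot T g = len T.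
Proof.
move=> hT [nacc _ _].
have am T1 : is_iet T1 -> limit_point (stop T1) (len T1) -> acc_max T1 (len T1).
  by move=> h1 l0; split=> // s /(limit_stop h1)/stop_itv; lra.
have [l0|/(rightmostP hT)[g g0]] := pselect (limit_point (stop T) (len T)); last first.
  by exists g; left.
have hI := is_iet_inv hT.
have [l0'|/(rightmostP hI)[g g0]] := pselect (limit_point (stop (inv_iet T)) (len T)).
  by case: nacc; split; [exact: am|exact: (am _ hI)].
by exists g; right.
Qed.

Definition omega_limit T x : set R :=
  [set y | forall e N, 0 < e -> exists2 n, (N <= n)%N & `|iter n (imap T) x - y| < e].

(** Here [d] may be an end point of the top interval: the orbit is only followed inside, which gives
    a one-sided continuity. *)
Lemma omega_limit_top T x g d : is_iet T -> 0 < d ->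
  (forall e N, 0 < e -> exists n, [/\ (N <= n)%N, top T g (iter n (imap T) x) &
     `|iter n (imap T) x - d| < e]) -> omega_limit T x (d + (lbot T g - ltop T g)).
Proof.
move=> hT d0 H e N e0; have [n [Nn gn ne]] := H e N e0.
exists n.+1; first exact: leqW.
rewrite /= (imapE hT gn) (_ : _ - _ = iter n (imap T) x - d) //; ring.
Qed.

Lemma omega_limit_bot T x g d : is_iet T -> 0 < x < len T -> fwd_inf T x ->
  (forall e N, 0 < e -> exists n, [/\ (N <= n)%N, bot T g (iter n (imap T) x) &
     `|iter n (imap T) x - d| < e]) -> omega_limit T x (d + (ltop T g - lbot T g)).
Proof.
move=> hT xl fx H e N e0; have [[|n] [Nn gn ne]] := H e N.+1 e0; first by rewrite ltn0 in Nn.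
exists n => //; have := iinvE hT gn.
rewrite /= imapNK //; last exact: fwd_inf_itv.
by move=> ->; rewrite (_ : _ - _ = iter n.+1 (imap T) x - d) //=; ring.
Qed.

Lemma omega_limit_invariant T x : is_iet T -> 0 < x < len T -> fwd_inf T x ->
  invariant T (omega_limit T x).
Proof.
move=> hT xl fx; split=> y Oy yl sy.
  have [a ay] := stopN_itv hT yl sy; rewrite (imapE hT ay).
  apply: omega_limit_top; [exact: hT|lra|] => e N e0.
  have [|n Nn] := Oy (Num.min e (Num.min (y - ltop T a) (rtop T a - y))) N.
    by rewrite !lt_min e0 /=; move: ay; rewrite topE; lra.
  rewrite !lt_min => /and3P[h1 h2 h3]; exists n; split=> //.
  by move: h2 h3; rewrite !ltr_norml topE; lra.
have [a ay] := stopN_itv (is_iet_inv hT) yl sy.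
have {}ay : bot T a y := ay; rewrite -/(iinv T y) (iinvE hT ay).
apply: omega_limit_bot => // e N e0.
have [|n Nn] := Oy (Num.min e (Num.min (y - lbot T a) (rbot T a - y))) N.
  by rewrite !lt_min e0 /=; move: ay; rewrite botE; lra.
rewrite !lt_min => /and3P[h1 h2 h3]; exists n; split=> //.
by move: h2 h3; rewrite !ltr_norml botE; lra.
Qed.

Lemma omega_limit_nonempty T x : is_iet T -> 0 < x < len T -> fwd_inf T x ->
  exists2 y, 0 <= y <= len T & omega_limit T x y.
Proof.
move=> hT xl fx.
have [|y [yl cy]] := @segment_compact R 0 (len T) ((fun n => iter n (imap T) x) @ \oo) _.
  by exists 0%N => // n _ /=; rewrite in_itv /=; have := fwd_inf_itv n hT xl fx; lra.
exists y; first by move: yl; rewrite /= in_itv.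
move=> e N e0.
have [] := cy [set iter n (imap T) x | n in [set n | (N <= n)%N]] (ball y e) _ _.
- by exists N => // n /= Nn; exists n.
- exact: nbhsx_ballx.
- by move=> _ [[n Nn <-] /= By]; exists n => //; rewrite distrC.
Qed.

Lemma invariant_orbit_sub T F y : is_iet T -> 0 < y < len T -> invariant T F ->
  F y -> orbit T y `<=` F.
Proof.
move=> hT yl [cF cB] Fy z [[N hN <-]|[N hN <-]].
  elim: N hN => //= N IH hN.
  apply: cF; first by apply: IH => n nN; apply: hN; lia.
    by apply: iter_imap_itv => // n nN; apply: hN; lia.
  exact: hN.
elim: N hN => //= N IH hN.
apply: cB; first by apply: IH => n nN; apply: hN; lia.
  by apply: iter_imap_itv => //; [exact: is_iet_inv|move=> n nN; apply: hN; lia].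
exact: hN.
Qed.

Lemma minimal_hits T x : is_iet T -> renormalizable T -> no_connection T ->
  minimal T -> 0 < x < len T -> fwd_inf T x -> hits_all T x.
Proof.
move=> hT rT nc mT xl fx p q p0 pq ql.
have iO := omega_limit_invariant hT xl fx.
have [[y yl Oy]|nO] := pselect (exists2 y, 0 < y < len T & omega_limit T x y).
  (* Without connections the orbit of [y] is infinite, hence dense, and it consists of limit points
     of the orbit of [x]. *)
  have iy : infinite_set (orbit T y).
    rewrite /orbit finite_setU => -[f1 f2].
    by apply: (nc y); split.
  have yd : dom T y by rewrite domE; lra.
  have := mT y yd iy ((p + q) / 2); rewrite domE => h.
  have [||z [oz]] := h _ (ball ((p + q) / 2) ((q - p) / 2)); try lra.
    by apply: nbhsx_ballx; lra.
  rewrite /ball /= => bz.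
  have Oz := invariant_orbit_sub hT yl iO Oy oz.
  have [|n _ nz] := Oz (Num.min (z - p) (q - z)) 0%N.
    by rewrite lt_min; move: bz; rewrite ltr_norml; lra.
  by exists n; move: nz; rewrite lt_min !ltr_norml; lra.
(* No interval is fixed, so the interval adjacent to an end point of the domain carries this end
   point to an interior limit point. *)
exfalso; have ne g : ltop T g <> lbot T g.
  by move=> /(fixed_connection hT)[z]; exact: nc.
have [y yl Oy] := omega_limit_nonempty hT xl fx.
have xn n := fwd_inf_itv n hT xl fx.
have [y0|y0] := eqVneq y 0.
  rewrite {}y0 in Oy; have [g [g0|g0]] := leftmost_exists hT rT.
    have tg := top_lt g hT; have lg := lbot_itv g hT.
    have : omega_limit T x (lbot T g).
      move=> e N e0; have [|n Nn] := Oy (Num.min e (rtop T g)) N.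
        by rewrite lt_min e0; lra.
      rewrite lt_min subr0 => /andP[h1 h2].
      have gn : top T g (iter n (imap T) x).
        by rewrite topE; move: h2; rewrite ltr_norml; have := xn n; lra.
      exists n.+1; first exact: leqW.
      by rewrite /= (imapE hT gn) g0 subr0 addrK.
    move=> Og; apply: nO; exists (lbot T g) => //.
    have h : lbot T g != 0 by apply/eqP => E; apply: (ne g); rewrite g0 E.
    by rewrite lt_neqAle eq_sym h; lra.
  have tg := bot_lt g hT; have lg := ltop_itv g hT.
  have : omega_limit T x (0 + (ltop T g - lbot T g)).
    apply: omega_limit_bot => // e N e0; have [|n Nn] := Oy (Num.min e (rbot T g)) N.
      by rewrite lt_min e0; lra.
    rewrite lt_min => /andP[h1 h2]; exists n; split=> //.
    by rewrite botE; move: h2; rewrite ltr_norml; have := xn n; lra.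
  rewrite add0r g0 subr0 => Og; apply: nO; exists (ltop T g) => //.
  by have := ne g; rewrite g0 => /eqP h; rewrite lt_neqAle eq_sym h; lra.
have [yE|y1] := eqVneq y (len T); last first.
  by apply: nO; exists y => //; rewrite !lt_neqAle eq_sym y0 y1.
rewrite {}yE in Oy; have [g [g0|g0]] := rightmost_exists hT rT.
  have tg := top_lt g hT; have wg := width g hT; have lg := lbot_itv g hT.
  have : omega_limit T x (len T + (lbot T g - ltop T g)).
    apply: omega_limit_top => // [|e N e0]; first by have := ltop_itv g hT; lra.
    have [|n Nn] := Oy (Num.min e (rtop T g - ltop T g)) N.
      by rewrite lt_min e0; lra.
    rewrite lt_min => /andP[h1 h2]; exists n; split=> //.
    by rewrite topE; move: h2; rewrite ltr_norml; have := xn n; lra.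
  move=> Og; apply: nO; exists (len T + (lbot T g - ltop T g)) => //.
  have := ne g; have := top_len g (is_iet_inv hT).
  by case: (ltgtP (ltop T g) (lbot T g)) => //= h; lra.
have tg := bot_lt g hT; have wg := width g hT; have lg := ltop_itv g hT.
have : omega_limit T x (len T + (ltop T g - lbot T g)).
  apply: omega_limit_bot => // e N e0.
  have [|n Nn] := Oy (Num.min e (rbot T g - lbot T g)) N.
    by rewrite lt_min e0; lra.
  rewrite lt_min => /andP[h1 h2]; exists n; split=> //.
  by rewrite botE; move: h2; rewrite ltr_norml; have := xn n; lra.
move=> Og; apply: nO; exists (len T + (ltop T g - lbot T g)) => //.
have := ne g; have := top_len g hT.
by case: (ltgtP (ltop T g) (lbot T g)) => //= h; lra.
Qed.

Lemma minimal_good T : is_iet T -> renormalizable T -> no_connection T ->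
  minimal T -> good T.
Proof.
move=> hT rT nc mT; split=> [x|x|x xl].
- exact: minimal_hits.
- apply: (@minimal_hits (inv_iet T)).
  + exact: is_iet_inv.
  + exact: renormalizable_inv.
  + by move=> y /connection_inv; exact: nc.
  + exact: minimal_inv.
- apply: contrapT => /not_orP[nf nb]; apply: (nc x).
  by split=> //; exact: fwd_finite.
Qed.

(** Points met halfway through a return are not in the target interval, being at [len T'] or
    beyond. *)
Lemma hits_induced T T' x : is_iet T' -> first_return T T' ->
  len T' < len T -> 0 < x < len T' -> fwd_inf T' x -> hits_all T x ->
  hits_all T' x.
Proof.
move=> hT' fr lT xl fx hx p q p0 pq ql.
have [|n pnq] := hx p q p0 pq; first lra.
have [j [[E|[_ cE]] _]] := track hT' fr lT n xl fx; last lra.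
by exists j; rewrite -E.
Qed.

Lemma good_rauzy T : is_iet T -> renormalizable T -> good T -> good (rauzy T).
Proof.
move=> hT rT [h1 h2 h3].
have hT' := is_iet_rauzy hT rT; have lT := rauzy_len hT rT.
have hI := is_iet_inv hT; have hI' := is_iet_inv hT'.
have fr := rauzy_first_return hT rT; have fr' := rauzy_first_return_inv hT rT.
have /andP[_ l1] := lT.
have xl' x : 0 < x < len (rauzy T) -> 0 < x < len T by lra.
split=> x xl.
- move=> fx; apply: (hits_induced hT' fr) => //; apply: h1; first exact: xl'.
  exact: (fwd_inf_of_induced hT' fr).
- move=> fx; apply: (hits_induced hI' fr') => //; apply: h2; first exact: xl'.
  exact: (fwd_inf_of_induced hI' fr').
- have [fx|fx] := h3 x (xl' x xl); [left|right].
    exact: (fwd_inf_induced hT fr).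
  exact: (fwd_inf_induced hI fr').
Qed.

Notation inf_renorm := infinitely_renormalizable.

Lemma good_iter T n : is_iet T -> inf_renorm T -> good T -> good (rauzy_iter n T).
Proof.
move=> hT rT gT; elim: n => //= n IH; apply: good_rauzy => //.
exact: is_iet_iter.
Qed.

Lemma iter_imap_translation T x n : is_iet T -> 0 < x < len T ->
  (forall m, (m < n)%N -> ~ stop T (iter m (imap T) x)) ->
  exists2 e, 0 < e & forall y, `|y - x| < e ->
    (forall m, (m < n)%N -> ~ stop T (iter m (imap T) y)) /\
    (forall m, (m <= n)%N -> iter m (imap T) y = iter m (imap T) x + (y - x)).
Proof.
move=> hT xl; elim: n => [|n IH] h.
  exists 1 => // y _; split=> // -[_|//] /=; ring.
have [|e e0 He] := IH; first by move=> m mn; apply: h; lia.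
have zl : 0 < iter n (imap T) x < len T.
  by apply: iter_imap_itv => // m mn; apply: h; lia.
have [a] := stopN_itv hT zl (h n (ltnSn n)); set z := iter n _ _ => az.
exists (Num.min e (Num.min (z - ltop T a) (rtop T a - z))).
  by rewrite !lt_min e0; move: az; rewrite topE; lra.
move=> y; rewrite !lt_min => /and3P[h1 h2 h3]; have [H1 H2] := He y h1.
have ay : top T a (iter n (imap T) y).
  by rewrite H2 // topE -/z; move: h2 h3; rewrite !ltr_norml; lra.
split=> m; rewrite ?ltnS leq_eqVlt => /predU1P[->|]; try by [exact: H1|exact: H2].
  exact: stopN_top ay.
by rewrite /= (imapE hT ay) (imapE hT az) H2 // -/z; ring.
Qed.

End Good.

(** * Lengths and towers of minimal exchanges *)

Section Shrink.
Variables (R : realType) (A : countType).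
Implicit Types (T : iet R A) (a b g w : A) (c s x y e p q L : R) (n k m : nat).

Notation inf_renorm := infinitely_renormalizable.

Definition returns T v x : Prop := exists2 j : nat, (0 < j)%N &
  (forall i, (i < j)%N -> ~ stop T (iter i (imap T) x)) /\ iter j (imap T) x < v.

Lemma returns_induced T T' v x : is_iet T -> first_return T T' ->
  len T' < len T -> 0 < x < len T' -> v <= len T' -> returns T v x ->
  returns T' v x.
Proof.
move=> hT [fA fB _ _] lT + vl [j].
elim/ltn_ind: j x => -[//|j] IH x xl _ [hs jv].
have xl0 : 0 < x < len T by lra.
have sx := hs 0%N isT.
have next y : imap T' x = y -> ~ stop T' x -> returns T' v y -> returns T' v x.
  move=> Tx sx' [i i0 [hi iv]]; exists i.+1 => //.
  split; last by rewrite iterSr Tx.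
  by move=> [_|k ki]; [exact: sx'|rewrite iterSr Tx; exact: (hi k ki)].
have last : ~ stop T' x -> imap T' x < v -> returns T' v x.
  by move=> sx' xv; exists 1%N => //; split=> // -[].
have [Tl|lT'] := ltP (imap T x) (len T').
  have [sx' Tx] := fA _ xl sx Tl.
  case: j IH hs jv => [|j] IH hs jv; first by apply: last; rewrite ?Tx.
  apply: (next _ Tx sx'); apply: (IH j.+1) => //.
    by have := imap_itv hT xl0 sx; lra.
  by split=> [i ij|]; rewrite -iterSr //; exact: (hs i.+1 ij).
case: j IH hs jv => [|j] IH hs jv; first by move: jv => /=; lra.
have sTx := hs 1%N isT.
have [sx' Tx Tc] := fB _ xl sx lT' sTx.
case: j IH hs jv => [|j] IH hs jv; first by apply: last; rewrite ?Tx.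
apply: (next _ Tx sx'); apply: (IH j.+1) => //.
  have h1 : 0 < imap T x < len T by exact: imap_itv.
  by have := imap_itv hT h1 sTx; lra.
by split=> [i ij|]; rewrite -!iterSr //; exact: (hs i.+2 ij).
Qed.

Lemma returns_iter T v x n : is_iet T -> inf_renorm T -> 0 < x ->
  x < len (rauzy_iter n T) -> v <= len (rauzy_iter n T) -> returns T v x ->
  returns (rauzy_iter n T) v x.
Proof.
move=> hT rT x0; elim: n => // n IH xl vl rx.
have hS := is_iet_iter n hT rT; have rS := rT n.
have lS := rauzy_len hS rS.
apply: (returns_induced hS (rauzy_first_return hS rS)) => //.
- by move: lS => /andP[].
- by rewrite x0.
- apply: IH => //; rewrite /= in xl vl lS *; lra.
Qed.

(** The losers land to the left of [len T + delta T w], and so does the new right end of [w]. *)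
Lemma topstep_sbot_static T c w y : is_iet T -> topcase T c w ->
  len T + delta T w < y < c -> sbot (topstep T c w) y <-> sbot T y.
Proof.
move=> hT tc yc; have lw := topcase_c hT tc; have rw := topcase_w tc.
split.
  by move=> /(sbot_topstep hT tc)[//|/stop_itv /=]; lra.
move=> sy; apply: contrapT => ny; have hT' := is_iet_topstep hT tc.
have [|g] := @sbotN _ _ (topstep T c w) y _ ny.
  by have := stop_itv sy; move=> /=; lra.
move/(topstep_bot hT tc) => [[cg /(loser_shift hT tc cg)[wy _]]|[_ [_ gy]]|[_]].
- exact: sbotN_bot wy sy.
- exact: sbotN_bot gy sy.
- by rewrite /delta in yc; lra.
Qed.

(* If the lengths decrease to L > 0 and only the top wins, then the winner is
   constant, the bottom singularities close to L on its right are never moved,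
   and they accumulate at L from the right. Then a tail must play and the cut
   be made at L. *)
Lemma top_always_wins T L : is_iet T -> inf_renorm T -> good T -> 0 < L ->
  (forall n, L < len (rauzy_iter n T)) ->
  (forall e, 0 < e -> exists n, len (rauzy_iter n T) < L + e) ->
  (forall n, exists w, topcase (rauzy_iter n T) (len (rauzy_iter n.+1 T)) w /\
     rauzy_iter n.+1 T = topstep (rauzy_iter n T) (len (rauzy_iter n.+1 T)) w) ->
  False.
Proof.
move=> hT rT gT L0 Ll lL top_.
pose S n := rauzy_iter n T; pose l n := len (S n).
have hS n : is_iet (S n) by exact: is_iet_iter.
have [w [tw0 _]] := top_ 0%N.
(* The winner stays the rightmost top interval, so only it can win the next step. *)
have stepw n : topcase (S n) (l n.+1) w /\ S n.+1 = topstep (S n) (l n.+1) w.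
  have [w' [tc E]] := top_ n; suff ww : w = w' by rewrite ww.
  suff rw : rightmost (S n) w by case: tc => rw' _ _; exact: rightmost_inj (hS n) rw rw'.
  elim: n {w' tc E} => [|n IH]; first by case: tw0.
  have [w' [tc E]] := top_ n; have [rw' _ _] := tc.
  have ww : w = w' by exact: rightmost_inj (hS n) IH rw'.
  by rewrite /rightmost {1}/S E /= ww eqxx.
pose d0 := delta T w.
have dE n : ltop (S n) w = ltop T w /\ lbot (S n) w = lbot T w.
  elim: n => // n [IH1 IH2]; have [tc E] := stepw n; rewrite E /=.
  by rewrite leNgt (topcase_nloser (hS n) tc) /= IH1 IH2.
have deltaE n : delta (S n) w = d0 by rewrite /delta; case: (dE n) => -> ->.
have d0_lt : d0 < 0 by exact: delta_lt0 hT tw0.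
have l_le m n : (m <= n)%N -> l n <= l m by exact: rauzy_iter_len_le.
(* From step [K] on, the losers jump to the left of [L]. *)
have [K lK] : exists K, l K < L - d0.
  by have [|K ?] := lL (- d0); [lra|exists K].
have sl n : sbot (S n) (l n.+1) by have [[]] := stepw n.
have static n y : (K <= n)%N -> L < y <= l n -> sbot (S n) y <-> sbot (S K) y.
  move=> /subnK <-; elim: (n - K)%N y => // {}n IH y yl.
  have [tc E] := stepw (n + K)%N.
  have h1 := l_le _ _ (leq_addl n K); have h2 := l_le _ _ (leqnSn (n + K)).
  have yl' : L < y <= l (n + K) by rewrite addSn in yl; lra.
  rewrite -IH //; rewrite addSn in yl *.
  have [yc|cy] := ltP y (l (n + K).+1).
    by rewrite {1}E topstep_sbot_static // deltaE -/(l _); lra.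
  have -> : y = l (n + K).+1 by lra.
  by split=> _; [exact: sl|exact: (stopl (is_iet_inv (hS _)))].
(* Being finite in number, the accumulation points do not come arbitrarily close to [L] from the
   right. *)
have [d dd gap] : exists2 d, 0 < d & forall p, limit_point (sbot (S K)) p -> L < p -> L + d <= p.
  have : ~ limit_point (limit_point (sbot (S K))) L.
    by apply: finite_no_limit_pt; case: (hS K) => _ _ [].
  move=> /not_limit_pt[d dd Hd]; exists d => // p lp Lp.
  by rewrite leNgt; apply/negP => pd; have := Hd _ lp; rewrite ger0_norm; lra.
have [n0 ln0] := lL d dd.
pose n := maxn K n0; have Kn : (K <= n)%N by exact: leq_maxl.
have ln : l n < L + d by have := l_le _ _ (leq_maxr K n0); rewrite -/n /l /S; lra.
have [tc E] := stepw n; have Lln := Ll n.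
have nolim p : limit_point (sbot (S n)) p -> p <= L.
  move=> lp; rewrite leNgt; apply/negP => Lp.
  have ss := stop_itv (limit_stop (is_iet_inv (hS n)) lp).
  suff : limit_point (sbot (S K)) p by move=> /gap/(_ Lp); rewrite /= -/(l n) in ss; lra.
  apply/limit_ptP => e e0; have /limit_ptP/(_ (Num.min e (p - L))) := lp.
  case=> [|y [yp sy]]; first by rewrite lt_min e0; lra.
  rewrite lt_min => /andP[h1 h2]; exists y; split=> //.
  apply/(static n) => //; have := stop_itv sy; rewrite /= -/(l n).
  by move: h2; rewrite ltr_norml; lra.
(* Each later cut is a bottom singularity when it is made, hence already at step [n]; the cuts tend
   to [L]. *)
have rsL : right_sided (sbot (S n)) L.
  apply/limit_ptP => e e0; have [m0 lm0] := lL e e0.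
  pose m := maxn n m0; have nm : (n <= m)%N by exact: leq_maxl.
  have lm := l_le _ _ (leqW (leq_maxr n m0)); have Lm : L < l m.+1 := Ll m.+1.
  have lm1 := l_le _ _ (leqnSn m); have lnm := l_le _ _ nm.
  have lm0' : l m0 < L + e := lm0.
  have h1 : L < l m.+1 <= l m by rewrite Lm lm1.
  have h2 : L < l m.+1 <= l n by rewrite Lm (le_trans lm1 lnm).
  exists (l m.+1); rewrite -/m in lm; split.
  - by rewrite neq_lt Lm orbT.
  - split=> //; apply: (static n _ Kn h2).2.
    exact: (static m _ (leq_trans Kn nm) h1).1 (sl m).
  - by rewrite ger0_norm; lra.
have lpL : limit_point (sbot (S n)) L by apply: limit_pt_sub rsL => y [].
have sL := limit_stop (is_iet_inv (hS n)) lpL.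
have rw : rightmost (S n) w by case: tc.
have Lw : top (S n) w L.
  rewrite topE rw Lln andbT lt_neqAle; apply/andP; split.
    (* Otherwise [L] would be singular on both sides, with no infinite half-orbit. *)
    apply/eqP => E'; have [_ _ h] := good_iter n hT rT gT.
    have [||] := h L; first by rewrite L0.
      by move=> /(_ 0%N); apply; rewrite /= -E'; exact: stop_ltop w (hS n).
    by move=> /(_ 0%N).
  rewrite leNgt; apply/negP => Lw; have [|m lm] := lL (ltop (S n) w - L); first lra.
  have [tcm _] := stepw m; have := topcase_c (hS m) tcm.
  have := l_le _ _ (leqnSn m); case: (dE m) => -> _; case: (dE n) => e1 _.
  by rewrite e1 in lm; rewrite /l /S; lra.
have tr : tail_right (S n) L.
  split=> //.
  - by move=> [/(rightmost_noacc (hS n) rw)].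
  - by move=> [/nolim] /=; rewrite leNgt Lln.
  - by exists w.
(* The tail rule puts the next cut at [L], which all lengths exceed. *)
have := Ll n.+1; rewrite /= (_ : new_len _ = L) ?ltxx //.
apply: xget_unique; first by apply: Or31; left.
by move=> y /= cy; apply: (cut_unique (hS n)) => //; apply: Or31; left.
Qed.

(** The forward orbit of [L] comes back to the left of [L], and that of a point just to its right
    does so along with it. Late cuts are such points, hence not top singularities, so the bottom no
    longer wins. *)
Lemma good_len_fwd T L : is_iet T -> inf_renorm T -> good T -> 0 < L ->
  (forall n, L < len (rauzy_iter n T)) ->
  (forall e, 0 < e -> exists n, len (rauzy_iter n T) < L + e) ->
  ~ fwd_inf T L.
Proof.
move=> hT rT gT L0 Ll lL fL.
have LT : 0 < L < len T by have := Ll 0%N; move=> /=; lra.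
have [hitL _ _] := gT.
have [|[|j] jL] := hitL L LT fL 0 L (lexx 0) L0; [lra|by move: jL => /=; lra|].
have [e e0 He] := @iter_imap_translation _ _ T L j.+1 hT LT (fun m _ => fL m).
have [K lK] : exists K, len (rauzy_iter K T) < L + Num.min e (L - iter j.+1 (imap T) L).
  by apply: lL; rewrite lt_min e0; move: jL => /=; lra.
have ret n y : L < y <= len (rauzy_iter K T) -> y < len (rauzy_iter n T) ->
    returns (rauzy_iter n T) L y.
  move=> yK yn; apply: returns_iter => //; first lra.
    exact: ltW.
  have lm : Num.min e (L - iter j.+1 (imap T) L) <= e by rewrite ge_min lexx.
  have lm' : Num.min e (L - iter j.+1 (imap T) L) <= L - iter j.+1 (imap T) L.
    by rewrite ge_min lexx orbT.
  have [|H1 H2] := He y; first by rewrite ger0_norm; lra.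
  by exists j.+1 => //; split=> //; rewrite H2 //; lra.
apply: (@top_always_wins (rauzy_iter K T) L) => //.
- exact: is_iet_iter.
- exact: inf_renorm_iter.
- exact: good_iter.
- by move=> n; rewrite -rauzy_iterD.
- move=> e' e'0; have [n ln] := lL _ e'0; exists n; rewrite -rauzy_iterD.
  by apply: le_lt_trans ln; apply: rauzy_iter_len_le => //; lia.
- move=> n; rewrite -!rauzy_iterD addSn; set m := (n + K)%N.
  have hS := is_iet_iter m hT rT.
  have [[c [w [tc cE E]]]|[c [w [tc cE E]]]] := rauzyP hS (rT m).
    by exists w; rewrite /= -cE E.
  have cl : len (rauzy_iter m.+1 T) = c by rewrite /= -cE.
  have [||i i0 [/(_ 0%N i0) nst _]] := ret m c.
  - rewrite -cl; apply/andP; split=> //; apply: rauzy_iter_len_le => //; lia.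
  - by have := topcase_c (is_iet_inv hS) tc; move=> /=; lra.
  - by case: nst; case: tc => _ _; rewrite /sbot inv_ietK.
Qed.

Lemma good_len_to0 T e : is_iet T -> inf_renorm T -> good T -> 0 < e ->
  exists n, len (rauzy_iter n T) < e.
Proof.
move=> hT rT gT e0; apply: contrapT => nex.
have el n : e <= len (rauzy_iter n T).
  by rewrite leNgt; apply/negP => h; apply: nex; exists n.
pose E := range (fun n => len (rauzy_iter n T)).
have hE : has_inf E by split; [exists (len T), 0%N|exists e => _ [n _ <-]].
pose L := inf E.
have L0 : 0 < L.
  apply: lt_le_trans e0 _; apply: lb_le_inf => [|_ [n _ <-]//]; exact: hE.1.
have Ll n : L < len (rauzy_iter n T).
  have h : L <= len (rauzy_iter n.+1 T) by apply: ge_inf; [exact: hE.2|exists n.+1].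
  apply: le_lt_trans h _.
  by have := rauzy_len (is_iet_iter n hT rT) (rT n); move=> /andP[].
have lL d : 0 < d -> exists n, len (rauzy_iter n T) < L + d.
  by move=> d0; have [_ [n _ <-] h] := inf_adherent d0 hE; exists n.
have [_ _ /(_ L)[]] := gT; first by rewrite L0; exact: (Ll 0%N).
  exact: good_len_fwd.
have hI := is_iet_inv hT.
apply: good_len_fwd => //.
- exact: inf_renorm_inv.
- exact: good_inv.
- by move=> n; rewrite rauzy_iter_inv //; exact: Ll.
- by move=> d /lL[n ln]; exists n; rewrite rauzy_iter_inv.
Qed.

(** * Following the towers along orbits *)

Lemma reach_visit T m a b x j : is_iet T -> inf_renorm T -> fwd_inf T x ->
  top (rauzy_iter m T) b x ->
  (forall i, (0 < i <= j)%N -> len (rauzy_iter m T) <= iter i (imap T) x) ->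
  top T a (iter j (imap T) x) -> reach T m a b.
Proof.
elim: m T a j => [|m IH] T a j hT rT fx.
  move=> /= bx hi ax; have xl := top_itv hT bx.
  (* Without induction steps the orbit never leaves the domain, which forces [j = 0]. *)
  case: j hi ax => [_ ax|j hi _]; first exact: top_inj hT ax bx.
  by exfalso; have := hi 1%N isT; have := fwd_inf_itv 1 hT xl fx; lra.
rewrite rauzy_iterS => bx hi ax.
have rT0 := inf_renorm0 rT; have hT' := is_iet_rauzy hT rT0.
have rT' := inf_renormS rT; have lT := rauzy_len hT rT0.
have xm := top_itv (is_iet_iter m hT' rT') bx.
have lm := rauzy_iter_len m hT' rT'.
have xl : 0 < x < len (rauzy T) by lra.
have /andP[_ l1] := lT; have fr := rauzy_first_return hT rT0.
have fx' : fwd_inf (rauzy T) x by exact: (fwd_inf_induced hT fr).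
have [j' [E Hj]] := track hT' fr l1 j xl fx'.
have [g gy] := stopN_itv hT' (fwd_inf_itv j' hT' xl fx') (fx' j').
have [v1 v2] := rauzy_visit a hT rT0 gy.
exists g.
  by case: E => [E|[E cE]]; [apply: v1; rewrite -E|apply: v2; rewrite -E].
apply: (IH _ _ j') => // i' /Hj[i hij ->].
exact: hi.
Qed.

(** Finds the level that starts at the original left end of [b]. This end moves only when [b] loses
    to a bottom winner, and one more application of the map undoes the move. *)
Lemma level_left_end T m b x : is_iet T -> inf_renorm T -> fwd_inf T x ->
  top (rauzy_iter m T) b x ->
  exists j, iter j (imap T) x = x - ltop (rauzy_iter m T) b + ltop T b /\
    forall i, (0 < i <= j)%N -> len (rauzy_iter m T) <= iter i (imap T) x.
Proof.
elim: m T => [|m IH] T hT rT fx.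
  by move=> _; exists 0%N; split=> [/=|[]//]; rewrite subrK.
rewrite rauzy_iterS => bx.
have rT0 := inf_renorm0 rT; have hT' := is_iet_rauzy hT rT0.
have rT' := inf_renormS rT; have lT := rauzy_len hT rT0.
have xm := top_itv (is_iet_iter m hT' rT') bx.
have lm := rauzy_iter_len m hT' rT'.
have xl : 0 < x < len (rauzy T) by lra.
have /andP[_ l1] := lT; have fr := rauzy_first_return hT rT0.
have fx' : fwd_inf (rauzy T) x by exact: (fwd_inf_induced hT fr).
have [j' [E' Hj']] := IH _ hT' rT' fx' bx.
have [n [En Hn]] := untrack hT' fr l1 j' xl fx'.
have yb : top (rauzy T) b (iter j' (imap (rauzy T)) x).
  have := @top_length_iter_le _ _ (rauzy T) b 0 m hT' rT' isT.
  rewrite E' /top_length topE /= => lb; move: bx; rewrite topE => bx; lra.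
have bnd i : (0 < i <= n)%N -> len (rauzy_iter m (rauzy T)) <= iter i (imap T) x.
  by move=> /Hn[h|[i' /Hj' h ->]] //; lra.
have [[lE _]|[cT _ _ TE]] := rauzy_left_end hT rT0 yb.
  by exists n; split=> //; rewrite -En E' lE.
exists n.+1; split=> [|i hi]; first by rewrite /= -En; lra.
have [->|ne] := eqVneq i n.+1; first by rewrite /= -En; lra.
by apply: bnd; lia.
Qed.

Lemma good_reach_lbot T a b N : is_iet T -> inf_renorm T -> good T ->
  0 < lbot T b -> exists2 n, (N <= n)%N & reach T n a b.
Proof.
move=> hT rT gT b0; have lb := lbot_itv b hT.
have [hits _ one] := gT; set z := lbot T b.
have zl : 0 < z < len T by rewrite /z; lra.
have fz : fwd_inf T z.
  (* The backward half-orbit of [z], a bottom singularity, stops at once. *)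
  by case: (one z zl) => // /(_ 0%N); case; exact: sbot_lbot.
have la := ltop_itv a hT; have ra := top_len a hT; have ltr_ab := top_lt a hT.
have [|||i iz] := hits z zl fz (ltop T a) (rtop T a); try lra.
have [e e0 He] := @iter_imap_translation _ _ T z i hT zl (fun m _ => fz m).
(* Once the domain is shorter than [v], the orbit of [z] does not meet it before reaching [a]. *)
have [v v0 Hv] : exists2 v, 0 < v & forall i', (i' <= i)%N -> v <= iter i' (imap T) z.
  elim: i {iz e e0 He} => [|i [v v0 Hv]].
    by exists z; [lra|case].
  have := fwd_inf_itv i.+1 hT zl fz => h.
  exists (Num.min v (iter i.+1 (imap T) z)); first by rewrite lt_min v0; lra.
  move=> i'; rewrite leq_eqVlt => /predU1P[->|]; first by rewrite ge_min lexx orbT.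
  by rewrite ltnS => /Hv h'; rewrite ge_min h'.
have [m0 lm0] := good_len_to0 hT rT gT v0.
pose m := maxn N m0; exists m; first exact: leq_maxl.
have lm := rauzy_iter_len_le hT rT (leq_maxr N m0); rewrite -/m in lm.
have hS := is_iet_iter m hT rT.
have lam := top_length_gt0 b hS.
(* A point less than [d] to the right of [z] follows [z] up to time [i] and is then in [top T a];
   the last term keeps [x] in the base [b]. *)
pose d := Num.min e (Num.min (rtop T a - iter i (imap T) z) (top_length (rauzy_iter m T) b)).
have d0 : 0 < d by rewrite /d !lt_min e0 lam; move: iz; lra.
have ld : d <= top_length (rauzy_iter m T) b by rewrite /d !ge_min lexx !orbT.
have lm' := rauzy_iter_len m hT rT.
have lS := top_len b hS.
have [|||x xd [xl fx _]] := @regular_dense _ _ T (ltop (rauzy_iter m T) b)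
    (ltop (rauzy_iter m T) b + d) hT; try by rewrite /top_length in ld; lra.
have bx : top (rauzy_iter m T) b x by rewrite topE /top_length in ld *; lra.
have [j [jE Hj]] := level_left_end hT rT fx bx.
have yb0 : top T b (iter j (imap T) x).
  have := @top_length_iter_le _ _ T b 0 m hT rT isT.
  by rewrite jE topE /top_length /= in ld *; lra.
(* At time [j] the orbit is just to the right of [ltop T b], so its next point is just to the right
   of [z]. *)
set y := iter j.+1 (imap T) x.
have yE : y = z + (x - ltop (rauzy_iter m T) b).
  by rewrite /y /= (imapE hT yb0) jE /z; ring.
have yd : y - z < d by rewrite yE; lra.
have [de d2] : d <= e /\ d <= rtop T a - iter i (imap T) z.
  by split; rewrite /d !ge_min lexx ?orbT.
have [|Hs Hi] := He y; first by rewrite ger0_norm yE; lra.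
apply: (@reach_visit T m a b x (i + j.+1)%N) => //.
- move=> i' /andP[i0 hi']; have [h|h] := leqP i' j; first by apply: Hj; rewrite i0.
  have h' : (i' - j.+1 <= i)%N by rewrite leq_subLR addnC.
  have := Hv _ h'; rewrite -(subnK h) iterD -/y (Hi _ h') addnK yE; lra.
- by rewrite iterD -/y Hi // topE; move: iz; lra.
Qed.

(** If [bot T b] starts at 0, then [top T b] does not, as no interval is fixed; the inverse
    exchange, which has the same [reach], is used instead. *)
Lemma good_reach T a b N : is_iet T -> inf_renorm T -> good T ->
  exists2 n, (N <= n)%N & reach T n a b.
Proof.
move=> hT rT gT; have lb := lbot_itv b hT; have lt := ltop_itv b hT.
have [b0|b0] := ltP 0 (lbot T b); first exact: good_reach_lbot.
have t0 : 0 < ltop T b.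
  rewrite lt_neqAle; apply/andP; split; last lra.
  by apply/eqP => E; apply: (good_no_fixed hT gT (g := b)); lra.
have [||n Nn] := @good_reach_lbot (inv_iet T) a b N (is_iet_inv hT) (inf_renorm_inv hT rT) _ _ => //.
  exact: good_inv.
by rewrite reach_inv // => rn; exists n.
Qed.

End Shrink.

Theorem theoremA (R : realType) (A : countType) (T : iet R A)
  (T_iet : is_iet T) (T_renorm : infinitely_renormalizable T) :
  combinatorially_minimal T <-> (no_connection T /\ minimal T).
Proof.
split=> [cm|[nc mT]].
  apply: all_reach_minimal => // k a b.
  have [n n0] := cm a b k.+1 isT.
  by rewrite rauzy_prod_reach // => rn; exists n.+1.
have gT := minimal_good T_iet (inf_renorm0 T_renorm) nc mT.
move=> a b k k0.
(* The product from [k] to [k + n] with [n > 0] has at least two factors, whence the bound 2. *)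
have [|||[|[|n]] // _ rn] := @good_reach _ _ (rauzy_iter k.-1 T) a b 2.
- exact: is_iet_iter.
- exact: inf_renorm_iter.
- exact: good_iter.
by exists n.+1 => //; rewrite rauzy_prod_reach.
Qed.
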